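(* Let $q\in[0,1)$ and $\beta>0$, and let $Q_p^{(q)}$ be the operator of multiplication by $x$ in $L^2(\mu_p^{(q)})$. Then $$S_{\mu_p^{(q)}}Q_p^{(q)}=(D_{q,\beta}+Z_q+\widetilde{\alpha}_{N_q})S_{\mu_p^{(q)}}.$$
   Context: Fix $q\in[0,1)$ and $\beta>0$; all function spaces are complex, inner products are antilinear in the first argument, and $0^0=1$. Notation: $[n]_q=1+q+\cdots+q^{n-1}$ with $[0]_q=0$; $[n]_q!=[1]_q\cdots[n]_q$ with $[0]_q!=1$; $(a;q)_n=\prod_{j=0}^{n-1}(1-aq^j)$ with $(a;q)_0=1$; $(a;q)_\infty=\prod_{j=0}^\infty(1-aq^j)$. The $q$-Charlier polynomials $\{C_n^{(q)}\}_{n\ge0}$ (with parameter $\beta$) are the monic polynomials defined by $C_0^{(q)}=1$, $C_1^{(q)}(x)=x-\beta$ and, for $n\ge1$, $$(x-[n]_q-\beta)C_n^{(q)}(x)=C_{n+1}^{(q)}(x)+\beta[n]_qC_{n-1}^{(q)}(x).$$ The $q$-deformed Poisson measure $\mu_p^{(q)}$ with parameter $\beta$ is the (unique, compactly supported) probability measure on $\mathbb R$ with respect to which the $C_n^{(q)}$ are orthogonal. They form an orthogonal basis of $L^2(\mu_p^{(q)})$ with $\|C_n^{(q)}\|^2_{L^2(\mu_p^{(q)})}=\beta^n[n]_q!$. Let $\Omega_q^\beta=\{z\in\mathbb C: |z|^2<\beta/(1-q)\}$. For $z\in\Omega_q^\beta$ the $q$-deformed coherent state vector is $$E^{(q)}_{\lambda,p}(x,z)=\sum_{n=0}^\infty\frac{C_n^{(q)}(x)}{\beta^n[n]_q!}z^n,$$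 which converges in $L^2(\mu_p^{(q)})$. The $q$-deformed Segal-Bargmann transform of $f\in L^2(\mu_p^{(q)})$ is the function on $\Omega_q^\beta$ given by $$(S_{\mu_p^{(q)}}f)(z)=\langle E^{(q)}_{\lambda,p}(\cdot,\overline z),f\rangle_{L^2(\mu_p^{(q)})};$$ it is a map from $L^2(\mu_p^{(q)})$ to the space ${\cal H}^2(\nu_q)$ defined next. Let $\nu_q$ be the measure on $\mathbb C$ $$\nu_q(dz)=(q;q)_\infty\sum_{j=0}^\infty\frac{q^j}{(q;q)_j}\lambda^\beta_{r_j}(dz),\qquad r_j=q^{j/2}\sqrt{\frac{\beta}{1-q}},$$ where $\lambda^\beta_{r}$ is the normalized (total mass $1$) Lebesgue measure on the circle of radius $r$ centered at $0$. The $q$-deformed Hardy space ${\cal H}^2(\nu_q)$ is the completion, with respect to the inner product $(F,G)_{{\cal H}^2_q}=\int\overline{F(z)}G(z)\,\nu_q(dz)$, of the space of functions holomorphic on a neighbourhood of the closed disc $\overline{\Omega_q^\beta}$. Its elements are identified with the holomorphic functions $F(z)=\sum_{n\ge0}a_nz^n$ on $\Omega_q^\beta$ such that $\|F\|^2_{{\cal H}^2_q}=\sum_{n\ge0}\beta^n[n]_q!|a_n|^2<\infty$. Operators on ${\cal H}^2(\nu_q)$ (all bounded, since $[n]_q\le 1/(1-q)$): the $q$-creation operator $Z_qF(z)=zF(z)$; the $q$-annihilation operator $$D_{q,\beta}F(z)=\frac{\beta(F(z)-F(qz))}{z(1-q)}\ (z\neq0),\qquad D_{q,\beta}F(0)=\beta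 F'(0);$$ and $\widetilde{\alpha}_{N_q}$, the bounded linear operator determined by $\widetilde{\alpha}_{N_q}z^n=([n]_q+\beta)z^n$ for all $n\ge0$. *)

(* Defs.v *)
From HB Require Import structures.
From mathcomp Require Import all_boot all_order all_algebra.
From mathcomp Require Import complex.
From mathcomp Require Import all_classical all_reals all_analysis.

Set Implicit Arguments.
Unset Strict Implicit.
Unset Printing Implicit Defensive.

Import Order.TTheory GRing.Theory Num.Theory.
Import numFieldNormedType.Exports.

Local Open Scope classical_set_scope.
Local Open Scope ring_scope.

(* Declaring the complex numbers at type numClosedFieldType (rather than writing
   R[i]) is what makes their canonical topology and normed structure available. *)
Definition Cplx (R : realType) : numClosedFieldType := complex R.

Section QCombinatorics.
Variables (R : realType) (q : R).

(* Note that 0 ^+ 0 = 1, so [n]_0 = 1 for n >= 1. *)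
Definition qnum (n : nat) : R := \sum_(i < n) q ^+ i.

Definition qfact (n : nat) : R := \prod_(i < n) qnum i.+1.

Fixpoint qcharlier (beta : R) (n : nat) : {poly R} :=
  match n with
  | 0%N => 1
  | m.+1 =>
    match m with
    | 0%N => 'X - beta%:P
    | k.+1 => ('X - (qnum m + beta)%:P) * qcharlier beta m
              - (beta * qnum m) *: qcharlier beta k
    end
  end.

End QCombinatorics.

Section L2.
Variables (R : realType) (mu : probability (measurableTypeR R) R).
Local Notation C := (Cplx R).

Definition Cintegral (f : R -> C) : C :=
  Complex (\int[mu]_x complex.Re (f x)) (\int[mu]_x complex.Im (f x)).

Definition inner (f g : R -> C) : C :=
  Cintegral (fun x => (f x)^* * g x).

Definition L2norm (f : R -> C) : \bar R :=
  Lnorm mu 2%:E (fun x => (Normc.normc (f x))%:E).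

(* Elements of L^2(mu) are handled through their representatives. *)
Definition L2 : set (R -> C) := [set f |
  [/\ measurable_fun [set: measurableTypeR R] (fun x => complex.Re (f x)),
      measurable_fun [set: measurableTypeR R] (fun x => complex.Im (f x)) &
      (L2norm f < +oo)%E]].

Definition Qp (f : R -> C) : R -> C := fun x => real_complex R x * f x.

End L2.

(* mu is the q-deformed Poisson measure. These two conditions determine mu: the
   recurrence gives all its moments, and its support is compact. *)
Definition is_qpoisson (R : realType) (q beta : R)
    (mu : probability (measurableTypeR R) R) : Prop :=
  (exists2 K : set R, compact K & mu (~` K) = 0%E) /\
  (forall m n : nat, m != n ->
     \int[mu]_x ((qcharlier q beta m).[x] * (qcharlier q beta n).[x]) = 0).

Section SegalBargmann.
Variables (R : realType) (q beta : R).
Local Notation C := (Cplx R).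

Definition Omega : set C :=
  [set z | Normc.normc z ^+ 2 < beta / (1 - q)].

Definition coherent_psum (z : C) (N : nat) : R -> C := fun x =>
  \sum_(n < N) real_complex R ((qcharlier q beta n).[x]
                               / (beta ^+ n * qfact q n)) * z ^+ n.

(* The sum of the series in L^2(mu), through a chosen representative. *)
Definition coherent (mu : probability (measurableTypeR R) R) (z : C) : R -> C :=
  get [set e | L2 mu e /\
    L2norm mu (fun x => coherent_psum z N x - e x) @[N --> \oo] --> 0%E].

Definition segal_bargmann (mu : probability (measurableTypeR R) R)
    (f : R -> C) : C -> C := fun z => inner mu (coherent mu z^*) f.

(* Functions on Omega are encoded as functions on C considered up to equality on
   Omega; values outside Omega are irrelevant. *)

Definition power_expansion (F : C -> C) (a : nat -> C) : Prop :=
  forall z, Omega z -> series (fun n => a n * z ^+ n) @ \oo --> F z.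

Definition hardy_weights (a : nat -> C) : nat -> R :=
  fun n => beta ^+ n * qfact q n * Normc.normc (a n) ^+ 2.

(* The q-deformed Hardy space, its elements being identified with holomorphic
   functions on Omega; the norm is that induced by nu_q. *)
Definition hardy : set (C -> C) := [set F |
  exists2 a, power_expansion F a & cvgn (series (hardy_weights a))].

Definition hardy_coef (F : C -> C) : nat -> C := get (power_expansion F).

Definition hardy_norm (F : C -> C) : R :=
  Num.sqrt (limn (series (hardy_weights (hardy_coef F)))).

(* Linearity and boundedness force A F and A G to agree on Omega whenever F and
   G do, so A does act on elements of the Hardy space. *)
Definition bounded_linear (A : (C -> C) -> (C -> C)) : Prop :=
  [/\ (forall F, hardy F -> hardy (A F)),
      (forall (c : C) F G, hardy F -> hardy G -> forall z, Omega z ->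
         A (fun w => c * F w + G w) z = c * A F z + A G z) &
      (exists M : R, forall F, hardy F -> hardy_norm (A F) <= M * hardy_norm F)].

Definition Zq (F : C -> C) : C -> C := fun z => z * F z.

Definition Dq (F : C -> C) : C -> C := fun z =>
  let b := real_complex R beta in
  let q' := real_complex R q in
  if z == 0 then b * derive1 F 0
  else b * (F z - F (q' * z)) / (z * (1 - q')).

(* The bounded linear operator determined by z^n |-> ([n]_q + beta) z^n. *)
Definition alphaN : (C -> C) -> (C -> C) :=
  get [set A | bounded_linear A /\
    forall (n : nat) (z : C), Omega z ->
      A (fun w => w ^+ n) z = real_complex R (qnum q n + beta) * z ^+ n].

End SegalBargmann.

(* Main.v *)
Require Import Defs.
From HB Require Import structures.
From mathcomp Require Import all_boot all_order all_algebra.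
From mathcomp Require Import ring lra.
From mathcomp Require Import complex.
From mathcomp Require Import all_classical all_reals all_analysis measurable_realfun.
Import Order.TTheory GRing.Theory Num.Theory.
Import numFieldNormedType.Exports.
Local Open Scope classical_set_scope.
Local Open Scope ring_scope.
Set Implicit Arguments.
Unset Strict Implicit.
Unset Printing Implicit Defensive.

(** Multiplication by x acts on the q-Charlier basis through the three-term
    recurrence, and the Segal-Bargmann transform turns the expansion of f in
    that basis into a power series. Since the C_n are real and orthogonal with
    |C_n|^2 = w_n := beta^n [n]_q!, the transform of f is
<<
      (S f)(z) = sum_n a_n z^n,   a_n = <C_n, f> / w_n.
>>
    Moving x onto C_n in <C_n, x f> and using
<<
      x C_n = C_(n+1) + ([n]_q + beta) C_n + beta [n]_q C_(n-1)
>>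
    together with w_(n+1) = beta [n+1]_q w_n, the n-th coefficient of S (Q f)
    is
<<
      beta [n+1]_q a_(n+1) + ([n]_q + beta) a_n + a_(n-1),
>>
    whose three terms are the coefficients of D (S f), of alpha_N (S f) and of
    Z (S f). Three points need an argument.

    The coherent vector has to exist as an L^2 function. Inside Omega,
    |z|^(2n) / w_n decays geometrically ([qweight_ge_geometric]), so the
    series of L^2 norms of the terms converges; hence the series converges
    absolutely almost everywhere and Fatou's lemma identifies its L^2 limit
    ([riesz_fischer_geometric]). Real and imaginary parts are treated
    separately, so all the integration theory is done for real functions. The
    values <C_n, C_n> = w_n follow from the orthogonality and the recurrence
    ([charlier_norm]), and the compact support keeps L^2 stable under
    multiplication by x. Continuity of the inner product then gives the power
    series of S f ([segal_bargmann_expansion]), and Bessel's inequality puts it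
    in the Hardy space ([segal_bargmann_hardy]).

    Coefficients of a power series are determined by its sum
    ([pexp_uniq]), and D at the origin reads off a_1 ([pexp_derive1_at0]);
    both come from the estimate |F z - sum_(i < m) a_i z^i| <= K |z|^m near 0
    ([pexp_taylor]).

    The operator alpha_N is only known to be bounded, linear and diagonal on
    monomials. A bounded linear operator with these values on monomials acts
    diagonally on every coefficient, because the tails of F tend to 0 in the
    Hardy norm ([bounded_linear_pexp]); and such an operator exists, as
    [n]_q = (1 - q^n) / (1 - q) makes it the explicit
<<
      F |-> (F(z) - F(q z)) / (1 - q) + beta F(z)
>>
    ([qnumber_op]). *)

(** * Square-integrable real functions *)

Section RealL2.
Context {d} {T : measurableType d} {R : realType}.
Variable mu : {measure set T -> \bar R}.
Local Notation L2R := (Lfun mu 2%:E).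

Lemma Lfun2P (f : T -> R) :
  f \in L2R <->
  measurable_fun setT f /\ mu.-integrable setT (EFin \o (fun x => f x ^+ 2)).
Proof.
split=> [fL|[mf /integrableP[_ fi]]].
  split; last exact: Lfun2_integrable_sqr.
  by move: fL; rewrite inE => /andP[]; rewrite inE.
rewrite inE/=; apply/andP; split; rewrite inE//= /finite_norm unlock poweR_lty//.
move: fi; congr (_ < _)%E; apply: eq_integral => x _ /=.
by rewrite powR_mulrn// normrX.
Qed.

Lemma eq_Lfun2 (f g : T -> R) : f =1 g -> f \in L2R -> g \in L2R.
Proof. by move=> /funext ->. Qed.

Lemma Lfun2_measurable (f : T -> R) : f \in L2R -> measurable_fun setT f.
Proof. by case/Lfun2P. Qed.

Lemma Lfun2_integrableM (f g : T -> R) : f \in L2R -> g \in L2R ->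
  mu.-integrable setT (EFin \o (fun x => f x * g x)).
Proof. by move=> fL gL; apply/Lfun1_integrable/Lfun2_mul_Lfun1. Qed.

Lemma Lfun2Z (f : T -> R) (a : R) : f \in L2R -> (fun x => a * f x) \in L2R.
Proof.
move=> fL; have -> : (fun x => a * f x) = a \o* f.
  by apply/funext => x /=; rewrite mulrC.
by apply: Lfun_scale => //; rewrite ler1n.
Qed.

Lemma Lfun2D (f g : T -> R) : f \in L2R -> g \in L2R ->
  (fun x => f x + g x) \in L2R.
Proof. by move=> fL gL; apply: (rpredD fL gL); rewrite lee1n. Qed.
(** Used for b x = x, which is bounded on the compact support of the measure. *)
Lemma Lfun2M_ae_bounded (b f : T -> R) (K : set T) (M : R) :
  measurable K -> mu (~` K) = 0%E -> measurable_fun setT b ->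
  (forall x, K x -> `|b x| <= M) -> f \in L2R -> (fun x => b x * f x) \in L2R.
Proof.
move=> mK K0 mb bM /Lfun2P[mf fI].
have mbf : measurable_fun setT (fun x => b x * f x) by exact: measurable_funM.
apply/Lfun2P; split=> //.
have mbf2 : measurable_fun setT (EFin \o (fun x => (b x * f x) ^+ 2)).
  by apply/measurable_EFinP; exact: measurable_funX.
apply/(negligible_integrable (measurableC mK) measurableT mbf2 K0).
rewrite setTD setCK.
apply: (le_integrable mK (g := EFin \o (fun x => M ^+ 2 * f x ^+ 2))).
- exact: measurable_funS mbf2.
- move=> x Kx; rewrite /= lee_fin exprMn !ger0_norm; try exact: mulr_ge0 (sqr_ge0 _) (sqr_ge0 _).
  rewrite ler_wpM2r ?sqr_ge0// -[b x ^+ 2]real_normK ?num_real//.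
  by rewrite lerXn2r ?nnegrE ?(le_trans _ (bM _ Kx))// bM.
- have MfI : mu.-integrable setT (EFin \o (fun x => M ^+ 2 * f x ^+ 2)).
    exact: (integrableZl measurableT (M ^+ 2) fI).
  exact: (integrableS measurableT mK (@subsetT _ _) MfI).
Qed.
End RealL2.

Section InnerProduct.
Context {d} {T : measurableType d} {R : realType}.
Variable mu : {measure set T -> \bar R}.
Local Notation L2R := (Lfun mu 2%:E).

Definition rdot (f g : T -> R) : R := \int[mu]_x (f x * g x).

Lemma rdotC f g : rdot f g = rdot g f.
Proof. by apply: eq_Rintegral => x _; exact: mulrC. Qed.

Lemma rdotZl a f g : f \in L2R -> g \in L2R ->
  rdot (fun x => a * f x) g = a * rdot f g.
Proof.
move=> fL gL; rewrite /rdot -RintegralZl//; last exact: Lfun2_integrableM.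
by apply: eq_Rintegral => x _; rewrite mulrA.
Qed.

Lemma rdotDl f g h : f \in L2R -> g \in L2R -> h \in L2R ->
  rdot (fun x => f x + g x) h = rdot f h + rdot g h.
Proof.
move=> fL gL hL; rewrite /rdot -RintegralD//; try exact: Lfun2_integrableM.
by apply: eq_Rintegral => x _; rewrite mulrDl.
Qed.

Lemma Lfun2B (f g : T -> R) : f \in L2R -> g \in L2R ->
  (fun x => f x - g x) \in L2R.
Proof.
move=> fL gL; by apply: eq_Lfun2 (Lfun2D fL (Lfun2Z (-1) gL)) => x; rewrite mulN1r.
Qed.

Lemma rdotBl f g h : f \in L2R -> g \in L2R -> h \in L2R ->
  rdot (fun x => f x - g x) h = rdot f h - rdot g h.
Proof.
move=> fL gL hL; rewrite /rdot -RintegralB//; try exact: Lfun2_integrableM.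
by apply: eq_Rintegral => x _; rewrite mulrBl.
Qed.

Lemma rdotBr f g h : f \in L2R -> g \in L2R -> h \in L2R ->
  rdot h (fun x => f x - g x) = rdot h f - rdot h g.
Proof. by move=> fL gL hL; rewrite rdotC rdotBl// !(rdotC _ h). Qed.

Lemma rdotNl f g : f \in L2R -> g \in L2R ->
  rdot (fun x => - f x) g = - rdot f g.
Proof.
move=> fL gL; rewrite -mulN1r -rdotZl//.
by apply: eq_Rintegral => x _; rewrite mulN1r.
Qed.

Lemma rdotZr a f g : f \in L2R -> g \in L2R ->
  rdot f (fun x => a * g x) = a * rdot f g.
Proof. by move=> fL gL; rewrite rdotC rdotZl// rdotC. Qed.

Lemma rdot_ge0 f : 0 <= rdot f f.
Proof. by apply: Rintegral_ge0 => x _; exact: (sqr_ge0 (f x)). Qed.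

Lemma rdot_sqrB f g : f \in L2R -> g \in L2R ->
  rdot (fun x => f x - g x) (fun x => f x - g x)
  = rdot f f - 2 * rdot f g + rdot g g.
Proof.
move=> fL gL; have fgL := Lfun2B fL gL.
rewrite rdotBl// !rdotBr// (rdotC g f).
by ring.
Qed.

(** The quadratic t |-> |f - t g|^2 is nonnegative; its minimum gives the bound,
    and a degenerate g forces <f, g> = 0. *)
Lemma cauchy_schwarz f g : f \in L2R -> g \in L2R ->
  rdot f g ^+ 2 <= rdot f f * rdot g g.
Proof.
move=> fL gL.
have quad t : 0 <= rdot f f - 2 * t * rdot f g + t ^+ 2 * rdot g g.
  have tgL := Lfun2Z t gL.
  have := rdot_ge0 (fun x => f x - t * g x).
  rewrite rdot_sqrB// rdotZl// !rdotZr//.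
  by congr (_ <= _); ring.
have := rdot_ge0 g; rewrite le_eqVlt => /predU1P[g0|g0].
  move: quad; rewrite -g0 mulr0 => quad.
  have [->|fg0] := eqVneq (rdot f g) 0; first by rewrite expr0n.
  have := quad ((rdot f f + 1) / (2 * rdot f g)).
  rewrite mulr0 addr0 (_ : 2 * _ * _ = rdot f f + 1); last by field.
  by lra.
have := quad (rdot f g / rdot g g).
rewrite (_ : _ + _ = rdot f f - rdot f g ^+ 2 / rdot g g); last first.
  by field; rewrite gt_eqF.
by rewrite subr_ge0 ler_pdivrMr.
Qed.

(** Continuity of the inner product in its first argument, from
    Cauchy-Schwarz. *)
Lemma rdot_cvg (u : nat -> T -> R) (f g : T -> R) :
  (forall n, u n \in L2R) -> f \in L2R -> g \in L2R ->
  rdot (fun x => u n x - f x) (fun x => u n x - f x) @[n --> \oo] --> 0 ->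
  rdot (u n) g @[n --> \oo] --> rdot f g.
Proof.
move=> uL fL gL u0.
have ub n : (rdot (u n) g - rdot f g) ^+ 2 <=
    rdot (fun x => u n x - f x) (fun x => u n x - f x) * rdot g g.
  rewrite -rdotBl//; apply: cauchy_schwarz => //; exact: Lfun2B.
apply/cvgrPdist_lt => e e0.
have ug0 : rdot (fun x => u n x - f x) (fun x => u n x - f x) * rdot g g
    @[n --> \oo] --> 0.
  by rewrite -(mul0r (rdot g g)); apply: cvgMl.
have := cvgr_lt _ ug0 (e ^+ 2); rewrite exprn_gt0// => /(_ _ isT).
apply: filterS => n un; rewrite distrC -ltr_sqr ?nnegrE ?(ltW e0)//.
by rewrite real_normK ?num_real// (le_lt_trans (ub n)).
Qed.

Lemma Lfun2_sum (c : nat -> R) (e : nat -> T -> R) k :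
  (forall n, e n \in L2R) -> (fun x => \sum_(i < k) c i * e i x) \in L2R.
Proof.
move=> eL; elim: k => [|k IH].
  by apply: eq_Lfun2 (Lfun2Z 0 (eL 0%N)) => x; rewrite big_ord0 mul0r.
apply: eq_Lfun2 (Lfun2D IH (Lfun2Z (c k) (eL k))) => x.
by rewrite big_ord_recr.
Qed.

Lemma rdot_suml (c : nat -> R) (e : nat -> T -> R) k g :
  (forall n, e n \in L2R) -> g \in L2R ->
  rdot (fun x => \sum_(i < k) c i * e i x) g = \sum_(i < k) c i * rdot (e i) g.
Proof.
move=> eL gL; elim: k => [|k IH].
  rewrite big_ord0 -[RHS](mul0r (rdot (e 0%N) g)) -rdotZl//.
  by apply: eq_Rintegral => x _ /=; rewrite big_ord0 !mul0r.
rewrite big_ord_recr/= -IH -rdotZl// -rdotDl ?Lfun2_sum ?Lfun2Z//.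
by apply: eq_Rintegral => x _ /=; rewrite big_ord_recr.
Qed.

Definition orthogonal_seq (e : nat -> T -> R) :=
  (forall n, e n \in L2R) /\ forall m n, m != n -> rdot (e m) (e n) = 0.

Lemma rdot_sum_sqr (c : nat -> R) (e : nat -> T -> R) k : orthogonal_seq e ->
  rdot (fun x => \sum_(i < k) c i * e i x) (fun x => \sum_(i < k) c i * e i x)
  = \sum_(i < k) c i ^+ 2 * rdot (e i) (e i).
Proof.
move=> [eL e0]; rewrite rdot_suml//; last exact: Lfun2_sum.
apply: eq_bigr => i _; rewrite rdotC rdot_suml// (bigD1 i)//= big1 ?addr0.
  by rewrite expr2 mulrA.
by move=> j ji; rewrite e0 ?mulr0.
Qed.

(** Expand |f - p|^2 >= 0 for p the projection of f on the first k vectors. *)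
Lemma bessel (e : nat -> T -> R) f k : orthogonal_seq e ->
  (forall n, 0 < rdot (e n) (e n)) -> f \in L2R ->
  \sum_(i < k) rdot (e i) f ^+ 2 / rdot (e i) (e i) <= rdot f f.
Proof.
move=> oe w0 fL; have [eL _] := oe; pose c i := rdot (e i) f / rdot (e i) (e i).
have := rdot_ge0 (fun x => f x - \sum_(i < k) c i * e i x).
rewrite rdot_sqrB// ?Lfun2_sum// rdot_sum_sqr// rdotC rdot_suml//.
rewrite (eq_bigr (fun i : 'I_k => rdot (e i) f ^+ 2 / rdot (e i) (e i))).
  rewrite [X in _ + X](eq_bigr (fun i : 'I_k => rdot (e i) f ^+ 2 / rdot (e i) (e i))).
    by set s := \sum_(i < k) _; lra.
  by move=> i _; rewrite /c; field; rewrite gt_eqF.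
by move=> i _; rewrite /c; field; rewrite gt_eqF.
Qed.
End InnerProduct.

(** * Convergence in mean of orthogonal series *)

Section RieszFischer.
Context {d} {T : measurableType d} {R : realType}.
Variable mu : probability T R.
Local Notation L2R := (Lfun mu 2%:E).
Local Notation dot := (rdot mu).

Lemma EFin_rdot (f g : T -> R) : f \in L2R -> g \in L2R ->
  (\int[mu]_x (f x * g x)%:E)%E = (dot f g)%:E.
Proof.
by move=> fL gL; rewrite fineK// integrable_fin_num//; exact: Lfun2_integrableM.
Qed.

(** On a probability space the L^1 norm is at most the L^2 norm: apply
    Cauchy-Schwarz to |f| and 1. *)
Lemma integral_norm_le (f : T -> R) (a : R) : 0 <= a -> f \in L2R ->
  dot f f <= a ^+ 2 -> (\int[mu]_x `|f x|%:E <= a%:E)%E.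
Proof.
move=> a0 fL fa.
have nL : (fun x => `|f x|) \in L2R.
  have [mf fi] := (Lfun2P mu f).1 fL.
  apply/Lfun2P; split; first exact: measurableT_comp.
  by move: fi; congr (_.-integrable _ _); apply/funext => x /=; rewrite real_normK ?num_real.
have oL : (fun=> 1 : R) \in L2R by exact: Lfun_cst.
under eq_integral do rewrite -[`|_|]mulr1.
rewrite (EFin_rdot nL oL) lee_fin.
apply: (@le_trans _ _ `|dot (fun x => `|f x|) (fun=> 1)|); first exact: ler_norm.
rewrite -ler_sqr ?nnegrE// real_normK ?num_real//.
apply: le_trans (cauchy_schwarz nL oL) _; apply: le_trans fa.
have -> : dot (fun=> 1) (fun=> 1) = 1.
  rewrite /rdot Rintegral_cst//.
  by rewrite !mul1r; exact: (congr1 fine (probability_setT mu)).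
rewrite mulr1 [leLHS](_ : _ = dot f f)//; apply: eq_Rintegral => x _ /=.
by rewrite -!expr2 real_normK ?num_real.
Qed.
(** The sum of the |u_n| has finite integral, the L^1 norms being dominated by
    a geometric series; so it is finite almost everywhere. *)
Lemma ae_cvg_series (u : nat -> T -> R) (a t : R) : 0 <= a -> 0 < t -> t < 1 ->
  (forall n, u n \in L2R) ->
  (forall n, dot (u n) (u n) <= (a * t ^+ n) ^+ 2) ->
  {ae mu, forall x, cvgn (series (u ^~ x))}.
Proof.
move=> a0 t0 t1 uL ub.
pose h n x : R := `|u n x|.
have mh n : measurable_fun setT (EFin \o h n).
  by apply/measurable_EFinP; apply: measurableT_comp => //; exact: Lfun2_measurable (uL n).
have h0 n x : (0 <= (h n x)%:E)%E by rewrite lee_fin normr_ge0.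
have int_sum : mu.-integrable setT (fun x => \sum_(n <oo) (h n x)%:E)%E.
  apply/integrableP; split.
    apply: (@ge0_emeasurable_sum _ _ _ setT (fun n => EFin \o h n) xpredT) => //.
    by move=> n x _ _ /=; rewrite lee_fin normr_ge0.
  have I0 x : (0 <= \sum_(n <oo) (h n x)%:E)%E.
    by apply: nneseries_ge0 => n _ _; rewrite lee_fin normr_ge0.
  under eq_integral do rewrite gee0_abs//.
  rewrite integral_nneseries//.
  apply: (@le_lt_trans _ _ (a * (1 - t)^-1)%:E); last exact: ltry.
  apply: lime_le; first by apply: is_cvg_nneseries => n _ _; apply: integral_ge0.
  near=> N.
  apply: (@le_trans _ _ (\sum_(0 <= i < N) (a * t ^+ i)%:E)%E).
    apply: lee_sum => i _; apply: integral_norm_le => //.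
    by rewrite mulr_ge0// exprn_ge0// ltW.
  rewrite sumEFin lee_fin; apply: geometric_le_lim => //.
  by rewrite ger0_norm// ltW.
have := integrable_ae measurableT int_sum; apply: filterS => x /(_ I) fin.
apply: normed_cvg; apply: nondecreasing_is_cvgn.
  by apply: nondecreasing_series => n _ _ /=.
exists (fine (\sum_(n <oo) (h n x)%:E)%E) => _ [n _ <-].
rewrite -lee_fin fineK// /= /series/= -sumEFin.
by apply: nneseries_lim_ge => *; rewrite lee_fin normr_ge0.
Unshelve. all: by end_near. Qed.

(** Completeness of L^2 in the only case needed, where no subsequence has to
    be extracted: with geometrically decaying terms the partial sums S_n
    converge almost everywhere to some g. Fatou's lemma in the second index
    transfers to S_N - g the bound on |S_N - S_M|^2 given by orthogonality. *)
Lemma riesz_fischer_geometric (e : nat -> T -> R) (c : nat -> R) (a t : R) :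
  orthogonal_seq mu e -> 0 <= a -> 0 < t -> t < 1 ->
  (forall n, c n ^+ 2 * dot (e n) (e n) <= (a * t ^+ n) ^+ 2) ->
  exists2 g, g \in L2R &
    dot (fun x => \sum_(i < n) c i * e i x - g x)
        (fun x => \sum_(i < n) c i * e i x - g x) @[n --> \oo] --> 0.
Proof.
move=> oe a0 t0 t1 ub; have [eL e0] := oe.
pose S n x := \sum_(i < n) c i * e i x.
have SL n : S n \in L2R by exact: Lfun2_sum.
have mS n := Lfun2_measurable (SL n).
pose g x := fine (limn_esup (fun n => (S n x)%:E)).
have mg : measurable_fun setT g.
  apply: (measurableT_comp (fine_measurable measurableT)).
  by apply: measurable_fun_limn_esup => n; apply/measurable_EFinP.
have Sg : {ae mu, forall x, S ^~ x @ \oo --> g x}.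
  have ueL n : (fun x => c n * e n x) \in L2R by exact: Lfun2Z.
  have ueb n : dot (fun x => c n * e n x) (fun x => c n * e n x) <= (a * t ^+ n) ^+ 2.
    by rewrite rdotZl// rdotZr// mulrA -expr2.
  have := ae_cvg_series a0 t0 t1 ueL ueb; apply: filterS => x /cvg_ex[l ul].
  have Sl : S ^~ x @ \oo --> l.
    suff -> : S ^~ x = series (fun n => c n * e n x) by [].
    by apply/funext => n; rewrite /series/= big_mkord.
  suff -> : g x = l by [].
  have SEl : (S n x)%:E @[n --> \oo] --> l%:E by apply/cvg_EFin => //; exact: nearW.
  by rewrite /g (cvg_limn_einf_sup SEl).2.
pose K := a ^+ 2 / (1 - t ^+ 2).
have t2 : t ^+ 2 < 1 by rewrite expr_lt1// ltW.
have SS N M : (N <= M)%N ->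
    dot (fun x => S N x - S M x) (fun x => S N x - S M x) <= K * (t ^+ 2) ^+ N.
  move=> /subnKC <-; move: (M - N)%N => k {M}.
  have oeN : orthogonal_seq mu (fun i => e (N + i)%N).
    by split=> // m n mn; rewrite e0// eqn_add2l.
  have := rdot_sum_sqr (fun i => - c (N + i)%N) k oeN.
  have <- : (fun x => S N x - S (N + k)%N x) =
            (fun x => \sum_(i < k) - c (N + i)%N * e (N + i)%N x).
    apply/funext => x; rewrite /S big_split_ord/= opprD addrA subrr sub0r.
    by rewrite -sumrN; apply: eq_bigr => i _; rewrite mulNr.
  move=> ->.
  apply: (@le_trans _ _ (series (geometric (a ^+ 2 * (t ^+ 2) ^+ N) (t ^+ 2)) k)).
    rewrite /series/= big_mkord; apply: ler_sum => i _; rewrite sqrrN.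
    by apply: le_trans (ub _) _; rewrite exprMn exprD exprMn (exprAC t 2 N) (exprAC t 2 i) mulrA.
  apply: le_trans (geometric_le_lim _ _ _ _) _ => //.
  - by rewrite mulr_ge0 ?sqr_ge0// exprn_ge0// sqr_ge0.
  - by rewrite exprn_gt0.
  - by rewrite ger0_norm// sqr_ge0.
  - by rewrite /K mulrAC.
have Sgb N : (\int[mu]_x ((S N x - g x) ^+ 2)%:E <= (K * (t ^+ 2) ^+ N)%:E)%E.
  have mSS M : measurable_fun setT (EFin \o (fun x => (S N x - S M x) ^+ 2)).
    apply/measurable_EFinP; apply: measurable_funX; exact: measurable_funB.
  have mSg : measurable_fun setT (EFin \o (fun x => (S N x - g x) ^+ 2)).
    apply/measurable_EFinP; apply: measurable_funX; exact: measurable_funB.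
  have -> : (\int[mu]_x ((S N x - g x) ^+ 2)%:E =
      \int[mu]_x limn_einf (fun M => ((S N x - S M x) ^+ 2)%:E))%E.
    apply: ge0_ae_eq_integral => //.
    + apply: measurableT_comp => //; apply: measurable_fun_limn_esup => M.
      by apply: measurableT_comp (mSS M); exact: oppe_measurable.
    + by move=> x _; rewrite lee_fin sqr_ge0.
    + move=> x _; rewrite limn_einf_lim; apply: lime_ge; first exact: is_cvg_einfs.
      apply: nearW => M; apply: le_ereal_inf_tmp => _ [k _ <-].
      by rewrite lee_fin sqr_ge0.
    + move: Sg; apply: filterS => x Sx _.
      have SEx : ((S N x - S M x) ^+ 2)%:E @[M --> \oo] --> ((S N x - g x) ^+ 2)%:E.
        apply/cvg_EFin; first exact: nearW.
        have Sc : S N x - S M x @[M --> \oo] --> S N x - g x.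
          by apply: cvgB => //; exact: cvg_cst.
        exact: (cvgM Sc Sc).
      by rewrite (cvg_limn_einf_sup SEx).1.
  apply: le_trans (@fatou _ _ _ mu _ measurableT _ mSS _) _ => //.
    by move=> M x _ /=; rewrite lee_fin sqr_ge0.
  rewrite limn_einf_lim; apply: lime_le; first exact: is_cvg_einfs.
  apply: nearW => M.
  apply: (@le_trans _ _ (\int[mu]_x ((S N x - S (maxn N M) x) ^+ 2)%:E)%E).
    by apply: ereal_inf_lbound; exists (maxn N M) => //=; exact: leq_maxr.
  under eq_integral do rewrite expr2.
  by rewrite EFin_rdot ?Lfun2B// lee_fin SS// leq_maxl.
have SgL N : (fun x => S N x - g x) \in L2R.
  apply/Lfun2P; split; first exact: measurable_funB.
  apply/integrableP; split.
    by apply/measurable_EFinP; apply: measurable_funX; exact: measurable_funB.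
  apply: le_lt_trans (ltry (K * (t ^+ 2) ^+ N)); apply: le_trans (Sgb N).
  under eq_integral do rewrite /= ger0_norm ?sqr_ge0//.
  by [].
exists g.
  by apply: eq_Lfun2 (Lfun2B (SL 0%N) (SgL 0%N)) => x; rewrite opprB addrC subrK.
have Kt0 : K * (t ^+ 2) ^+ n @[n --> \oo] --> 0.
  by apply: cvg_geometric; rewrite ger0_norm// sqr_ge0.
apply: (squeeze_cvgr _ (cvg_cst 0) Kt0); apply: nearW => n.
have := Sgb n; under eq_integral do rewrite expr2.
by rewrite EFin_rdot// lee_fin => ->; rewrite rdot_ge0.
Qed.
End RieszFischer.

(** * q-numbers and q-Charlier polynomials *)

Section QNumbers.
Variables (R : realType) (q beta : R).
Hypotheses (q_ge0 : 0 <= q) (q_lt1 : q < 1) (beta_gt0 : 0 < beta).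

Lemma qnum0 : qnum q 0 = 0. Proof. by rewrite /qnum big_ord0. Qed.

Lemma qnumS n : qnum q n.+1 = qnum q n + q ^+ n.
Proof. by rewrite /qnum big_ord_recr. Qed.

Lemma qnumE n : qnum q n = (1 - q ^+ n) / (1 - q).
Proof.
have q1 : 1 - q != 0 by rewrite subr_eq0 gt_eqF.
elim: n => [|n IH]; first by rewrite qnum0 expr0 subrr mul0r.
by rewrite qnumS IH exprS; field.
Qed.

Lemma qnum_gt0 n : 0 < qnum q n.+1.
Proof.
rewrite qnumE divr_gt0// ?subr_gt0// exprS (le_lt_trans _ q_lt1)//.
by rewrite ler_piMr// exprn_ile1// ltW.
Qed.

Lemma qnum_ge0 n : 0 <= qnum q n.
Proof. by case: n => [|n]; rewrite ?qnum0// ltW// qnum_gt0. Qed.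

Lemma qnum_le n : qnum q n <= (1 - q)^-1.
Proof.
rewrite qnumE ler_piMl// ?invr_ge0 ?subr_ge0 ?(ltW q_lt1)//.
by rewrite gerBl exprn_ge0.
Qed.

(** The squared norm of the n-th q-Charlier polynomial, which is also that of
    z^n in the Hardy space. *)
Definition qweight n : R := beta ^+ n * qfact q n.

Lemma qweight0 : qweight 0 = 1.
Proof. by rewrite /qweight /qfact big_ord0 mulr1. Qed.

Lemma qweightS n : qweight n.+1 = beta * qnum q n.+1 * qweight n.
Proof. by rewrite /qweight /qfact big_ord_recr/= exprS; ring. Qed.

Lemma qweight_gt0 n : 0 < qweight n.
Proof.
elim: n => [|n IH]; first by rewrite qweight0.
by rewrite qweightS mulr_gt0// mulr_gt0// qnum_gt0.
Qed.

(** The ratios beta [n+1]_q of consecutive weights tend to beta / (1 - q), the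
    squared radius of the disc, so they eventually exceed any smaller s. *)
Lemma qweight_ge_geometric s : 0 < s -> s < beta / (1 - q) ->
  exists2 c, 0 < c & forall n, c * s ^+ n <= qweight n.
Proof.
move=> s0 sb.
have q1 : 0 < 1 - q by rewrite subr_gt0.
have [N sN] : exists N, forall n, (N <= n)%N -> s <= beta * qnum q n.+1.
  have : beta * (1 - q ^+ n) / (1 - q) @[n --> \oo] --> beta * (1 - 0) / (1 - q).
    apply: cvgMl; apply: cvgMr; apply: cvgB; first exact: cvg_cst.
    by apply: cvg_expr; rewrite ger0_norm.
  rewrite subr0 mulr1 => /cvgr_gt/(_ _ sb)[N _ Ns].
  exists N => n Nn; have /ltW := Ns n.+1 (leq_trans Nn (leqnSn n)).
  by rewrite qnumE mulrA.
have [c c0 cN] : exists2 c, 0 < c & forall n, (n <= N)%N -> c * s ^+ n <= qweight n.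
  elim: N {sN} => [|N [c c0 cN]].
    by exists 1 => // n; rewrite leqn0 => /eqP ->; rewrite qweight0 expr0 mulr1.
  exists (Num.min c (qweight N.+1 / s ^+ N.+1)).
    by rewrite lt_min c0 divr_gt0 ?qweight_gt0// exprn_gt0.
  move=> n; rewrite leq_eqVlt => /predU1P[->|nN].
    by rewrite -ler_pdivlMr ?exprn_gt0// ge_min lexx orbT.
  apply: le_trans (cN _ nN); apply: ler_wpM2r; last by rewrite ge_min lexx.
  by rewrite exprn_ge0// ltW.
exists c => // n; have [/cN//|/ltnW] := leqP n N.
elim: n => [|n IH]; first by rewrite leqn0 => /eqP N0; apply: cN; rewrite N0.
rewrite leq_eqVlt => /predU1P[<-|Nn]; first exact: cN.
rewrite qweightS exprS mulrCA ler_pM//; last exact: IH.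
- exact: ltW.
- by rewrite mulr_ge0 ?exprn_ge0 ?ltW.
- exact: sN.
Qed.
End QNumbers.

Section QCharlier.
Variables (R : realType) (q beta : R).
Hypotheses (q_ge0 : 0 <= q) (q_lt1 : q < 1) (beta_gt0 : 0 < beta).
Variable mu : probability (measurableTypeR R) R.
Hypothesis mu_qpoisson : is_qpoisson q beta mu.
Local Notation L2R := (Lfun mu 2%:E).
Local Notation w := (qweight q beta).

Lemma Lfun2_mulX (u : measurableTypeR R -> R) : u \in L2R ->
  (fun x => x * u x) \in L2R.
Proof.
have [[K cK K0] _] := mu_qpoisson.
have mK : measurable (K : set (measurableTypeR R)) := compact_measurable cK.
have [M [_ KM]] := compact_bounded cK.
apply: (@Lfun2M_ae_bounded _ _ _ mu id u K (M + 1)) => // x Kx.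
by apply: (KM (M + 1)) => //; rewrite ltrDl.
Qed.

Lemma Lfun2_poly (p : {poly R}) : (fun x : measurableTypeR R => p.[x]) \in L2R.
Proof.
elim/poly_ind: p => [|p c IH].
  by apply: eq_Lfun2 (Lfun_cst mu 0 2) => x; rewrite horner0.
apply: eq_Lfun2 (Lfun2D (Lfun2_mulX IH) (Lfun_cst mu c 2)) => x.
by rewrite !hornerE mulrC.
Qed.

Definition charlier n (x : measurableTypeR R) : R := (qcharlier q beta n).[x].

Lemma charlier0 x : charlier 0 x = 1.
Proof. by rewrite /charlier hornerE. Qed.

(** At n = 0 the last term vanishes because [0]_q = 0, so the value 0 of the
    predecessor of 0 is harmless and one formula covers all n. *)
Lemma charlier_mulX n x :
  x * charlier n x = charlier n.+1 x + (qnum q n + beta) * charlier n x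
                     + beta * qnum q n * charlier n.-1 x.
Proof.
case: n => [|n]; rewrite /charlier; last by rewrite /= !hornerE; ring.
by rewrite /= qnum0 hornerD hornerN hornerX !hornerC; ring.
Qed.

Lemma charlier_orthogonal : orthogonal_seq mu charlier.
Proof. by split=> [n|]; [exact: Lfun2_poly|exact: mu_qpoisson.2]. Qed.

Lemma rdot_charlier_mulX n f : f \in L2R ->
  rdot mu (charlier n) (fun x => x * f x) =
  rdot mu (charlier n.+1) f + (qnum q n + beta) * rdot mu (charlier n) f
  + beta * qnum q n * rdot mu (charlier n.-1) f.
Proof.
move=> fL; have [cL _] := charlier_orthogonal.
rewrite -!rdotZl// -!rdotDl ?Lfun2D ?Lfun2Z//.
apply: eq_Rintegral => x _ /=; rewrite mulrCA mulrA charlier_mulX; ring.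
Qed.

(** Computing the inner product of x C_n and C_(n+1) with the recurrence of
    either factor gives |C_(n+1)|^2 = beta [n+1]_q |C_n|^2. *)
Lemma charlier_norm n : rdot mu (charlier n) (charlier n) = w n.
Proof.
have [cL c0] := charlier_orthogonal.
elim: n => [|n IH].
  have -> : rdot mu (charlier 0) (charlier 0) = \int[mu]_x 1.
    by apply: eq_Rintegral => x _; rewrite charlier0 mulr1.
  rewrite Rintegral_cst// mul1r qweight0.
  exact: (congr1 fine (probability_setT mu)).
have E1 := rdot_charlier_mulX n (cL n.+1).
have E2 := rdot_charlier_mulX n.+1 (cL n).
rewrite (c0 n n.+1) ?neq_ltn ?ltnSn// (c0 n.-1 n.+1) in E1; last first.
  by rewrite neq_ltn (leq_ltn_trans (leq_pred n) (ltnSn n)).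
rewrite (c0 n.+2 n) ?neq_ltn ?(ltnW (ltnSn _)) ?orbT// (c0 n.+1 n) in E2; last first.
  by rewrite neq_ltn ltnSn orbT.
rewrite qweightS -IH.
have E3 : rdot mu (charlier n) (fun x => x * charlier n.+1 x) =
          rdot mu (charlier n.+1) (fun x => x * charlier n x).
  by apply: eq_Rintegral => x _; ring.
move: E1; rewrite E3 E2 /= !mulr0 !addr0 !add0r => <-.
by [].
Qed.
End QCharlier.

(** * Complex numbers through real and imaginary parts *)

Section ComplexNorm.
Variable R : realType.
Local Notation C := (Cplx R).
Local Notation normc := Normc.normc.
Implicit Types (x y z : C) (u : nat -> C).

Lemma normC_normc z : `|z| = real_complex R (normc z).
Proof. by []. Qed.

Lemma normc_ge0 z : 0 <= normc z.
Proof. by case: z => a b; exact: sqrtr_ge0. Qed.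

Lemma normc_sqrE z : normc z ^+ 2 = complex.Re z ^+ 2 + complex.Im z ^+ 2.
Proof. by case: z => a b; rewrite sqr_sqrtr// addr_ge0 ?sqr_ge0. Qed.

Lemma normcX z n : normc (z ^+ n) = normc z ^+ n.
Proof.
elim: n => [|n IH]; first exact: (Normc.normc1 R).
by rewrite !exprS -IH; exact: Normc.normcM.
Qed.

Lemma normc_real (a : R) : normc (real_complex R a : C) = `|a|.
Proof. by rewrite /normc/= expr0n addr0 sqrtr_sqr. Qed.

Lemma ler_normc_sum (I : Type) (r : seq I) (P : pred I) (F : I -> C) :
  normc (\sum_(i <- r | P i) F i) <= \sum_(i <- r | P i) normc (F i).
Proof.
apply: (big_ind2 (fun x a => normc x <= a)) => // [|x a y b xa yb].
  by rewrite (Normc.normc0 R).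
by apply: le_trans (le_normcD _ _) _; exact: lerD.
Qed.

Lemma ler_normc_ReIm z : normc z <= `|complex.Re z| + `|complex.Im z|.
Proof.
rewrite -ler_sqr ?nnegrE ?normc_ge0 ?addr_ge0// normc_sqrE sqrrD !real_normK ?num_real//.
by rewrite lerD2r lerDl mulrn_wge0// mulr_ge0.
Qed.

(** The norm of the complex field is complex-valued, so convergence has to be
    transported to the real-valued modulus before using real estimates. *)
Lemma cvgC_normP u (l : C) :
  u @ \oo --> l <-> normc (u n - l) @[n --> \oo] --> (0 : R).
Proof.
split=> [/cvgrPdist_lt ul|/cvgrPdist_lt ul]; apply/cvgrPdist_lt => e e0.
  have := ul (real_complex R e); rewrite ltcR => /(_ e0); apply: filterS => n.
  rewrite distrC normC_normc ltcR sub0r normrN ger0_norm ?normc_ge0//.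
move: e0; rewrite ltcE => /andP[/eqP/= ie re].
have := ul _ re; apply: filterS => n.
rewrite sub0r normrN ger0_norm ?normc_ge0// => un.
rewrite distrC normC_normc ltcE /= un andbT; exact/eqP.
Qed.

Lemma cvgC_ReIm u (l : C) :
  complex.Re (u n) @[n --> \oo] --> complex.Re l ->
  complex.Im (u n) @[n --> \oo] --> complex.Im l -> u @ \oo --> l.
Proof.
move=> rl il; apply/cvgC_normP.
have ub : `|complex.Re (u n) - complex.Re l| + `|complex.Im (u n) - complex.Im l|
    @[n --> \oo] --> (0 : R).
  rewrite -[X in _ --> X](addr0 0); apply: cvgD.
    by apply/norm_cvg0P; rewrite -(subrr (complex.Re l)); apply: cvgB => //; exact: cvg_cst.
  by apply/norm_cvg0P; rewrite -(subrr (complex.Im l)); apply: cvgB => //; exact: cvg_cst.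
apply: (squeeze_cvgr _ (cvg_cst 0) ub); apply: nearW => n.
rewrite normc_ge0; apply: le_trans (ler_normc_ReIm _) _.
by case: (u n) => a b; case: (l).
Qed.

Lemma ReD x y : complex.Re (x + y) = complex.Re x + complex.Re y.
Proof. by case: x y => [a b] [c d]. Qed.

Lemma ImD x y : complex.Im (x + y) = complex.Im x + complex.Im y.
Proof. by case: x y => [a b] [c d]. Qed.

Lemma ReN x : complex.Re (- x) = - complex.Re x. Proof. by case: x. Qed.

Lemma ImN x : complex.Im (- x) = - complex.Im x. Proof. by case: x. Qed.

Lemma Re_conjX z n : complex.Re (z^* ^+ n) = complex.Re (z ^+ n).
Proof. by rewrite -rmorphXn; case: (z ^+ n). Qed.

Lemma Im_conjX z n : complex.Im (z^* ^+ n) = - complex.Im (z ^+ n).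
Proof. by rewrite -rmorphXn; case: (z ^+ n). Qed.

Lemma Re_sum (I : Type) (r : seq I) (P : pred I) (F : I -> C) :
  complex.Re (\sum_(i <- r | P i) F i) = \sum_(i <- r | P i) complex.Re (F i).
Proof. exact: (big_morph _ ReD). Qed.

Lemma Im_sum (I : Type) (r : seq I) (P : pred I) (F : I -> C) :
  complex.Im (\sum_(i <- r | P i) F i) = \sum_(i <- r | P i) complex.Im (F i).
Proof. exact: (big_morph _ ImD). Qed.
End ComplexNorm.

(** * Coherent vectors and the coefficients of the transform *)

Section ComplexL2.
Variables (R : realType) (mu : probability (measurableTypeR R) R).
Local Notation C := (Cplx R).
Local Notation L2R := (Lfun mu 2%:E).
Local Notation Re f := (fun x : measurableTypeR R => complex.Re (f x)).
Local Notation Im f := (fun x : measurableTypeR R => complex.Im (f x)).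

Lemma L2norm_poweR (f : R -> C) :
  (L2norm mu f `^ 2 = \int[mu]_x (complex.Re (f x) ^+ 2 + complex.Im (f x) ^+ 2)%:E)%E.
Proof.
rewrite /L2norm powR_Lnorm; last by rewrite pnatr_eq0.
apply: eq_integral => x _ /=.
by rewrite powR_mulrn// ger0_norm ?normc_ge0// normc_sqrE.
Qed.

(** Reduces complex square integrability to the real theory; it rests on
    |f|^2 = (Re f)^2 + (Im f)^2. *)
Lemma L2P (f : R -> C) : L2 mu f <-> Re f \in L2R /\ Im f \in L2R.
Proof.
have mE (g : measurableTypeR R -> R) : measurable_fun setT g ->
    measurable_fun setT (EFin \o (fun x => g x ^+ 2)).
  by move=> mg; apply/measurable_EFinP; exact: measurable_funX.
have abs2 (g : measurableTypeR R -> R) :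
  (\int[mu]_x `|(EFin \o (fun x => (g x ^+ 2)%R)) x| = \int[mu]_x (g x ^+ 2)%:E)%E.
  by apply: eq_integral => x _ /=; rewrite ger0_norm// sqr_ge0.
split=> [[mre mim fi]|[/Lfun2P[mre /integrableP[_ rei]] /Lfun2P[mim /integrableP[_ imi]]]].
  have := poweR_lty 2 fi; rewrite L2norm_poweR => sumi.
  split; apply/Lfun2P; split=> //; apply/integrableP; split; try exact: mE.
    rewrite abs2; apply: le_lt_trans sumi; apply: ge0_le_integral => //.
    - by move=> x _; rewrite lee_fin sqr_ge0.
    - exact: mE.
    - by apply/measurable_EFinP; apply: measurable_funD; exact: measurable_funX.
    - by move=> x _; rewrite lee_fin lerDl sqr_ge0.
  rewrite abs2; apply: le_lt_trans sumi; apply: ge0_le_integral => //.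
  - by move=> x _; rewrite lee_fin sqr_ge0.
  - exact: mE.
  - by apply/measurable_EFinP; apply: measurable_funD; exact: measurable_funX.
  - by move=> x _; rewrite lee_fin lerDr sqr_ge0.
split=> //; apply: (@lty_poweRy _ _ 2); first by rewrite pnatr_eq0.
rewrite L2norm_poweR; under eq_integral do rewrite EFinD.
rewrite ge0_integralD//; try first [exact: mE | by move=> x _; rewrite lee_fin sqr_ge0].
by rewrite lte_add_pinfty// -abs2.
Qed.

Lemma L2normE (f : R -> C) : L2 mu f ->
  L2norm mu f = (Num.sqrt (rdot mu (Re f) (Re f) + rdot mu (Im f) (Im f)))%:E.
Proof.
move=> /L2P[reL imL].
have : (L2norm mu f `^ 2 = (rdot mu (Re f) (Re f) + rdot mu (Im f) (Im f))%:E)%E.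
  rewrite L2norm_poweR EFinD -!EFin_rdot// -ge0_integralD//.
  - by move=> x _; rewrite -expr2 lee_fin sqr_ge0.
  - by apply/measurable_EFinP; apply: measurable_funM; exact: (Lfun2_measurable reL).
  - by move=> x _; rewrite -expr2 lee_fin sqr_ge0.
  - by apply/measurable_EFinP; apply: measurable_funM; exact: (Lfun2_measurable imL).
have := Lnorm_ge0 mu 2%:E (fun x => (Normc.normc (f x))%:E).
rewrite -/(L2norm mu f); case: (L2norm mu f) => [r|_|//].
  rewrite lee_fin => r0 [<-].
  by rewrite powR_mulrn// sqrtr_sqr ger0_norm.
by rewrite poweRyr// pnatr_eq0.
Qed.

Lemma L2norm_cvg0P (u : nat -> R -> C) : (forall n, L2 mu (u n)) ->
  L2norm mu (u n) @[n --> \oo] --> 0%E <->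
  (rdot mu (Re (u n)) (Re (u n)) @[n --> \oo] --> 0 /\
   rdot mu (Im (u n)) (Im (u n)) @[n --> \oo] --> 0).
Proof.
move=> uL; pose s n := rdot mu (Re (u n)) (Re (u n)) + rdot mu (Im (u n)) (Im (u n)).
have s0 n : 0 <= s n by rewrite addr_ge0// rdot_ge0.
have -> : (fun n => L2norm mu (u n)) = EFin \o (fun n => Num.sqrt (s n)).
  by apply/funext => n /=; rewrite L2normE.
split=> [/fine_cvgP[_ /= h]|[rec imc]].
  have sc : s n @[n --> \oo] --> 0.
    suff -> : s = (fun n => Num.sqrt (s n) * Num.sqrt (s n)).
      by rewrite -[X in _ --> X](mulr0 (0 : R)); exact: (cvgM h h).
    by apply/funext => n; rewrite -expr2 sqr_sqrtr.
  by split; apply: (squeeze_cvgr _ (cvg_cst 0) sc); apply: nearW => n;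
    rewrite rdot_ge0 /s ?lerDl ?lerDr rdot_ge0.
apply/cvg_EFin; first exact: nearW.
have sc : s n @[n --> \oo] --> (0 : R).
  by rewrite -[X in _ --> X](addr0 (0 : R)); exact: (cvgD rec imc).
by rewrite -sqrtr0; exact: (cvg_comp _ _ sc (@sqrt_continuous R 0)).
Qed.
Lemma innerE (f g : R -> C) : L2 mu f -> L2 mu g ->
  inner mu f g = Complex (rdot mu (Re f) (Re g) + rdot mu (Im f) (Im g))
                         (rdot mu (Re f) (Im g) - rdot mu (Im f) (Re g)).
Proof.
move=> /L2P[fR fI] /L2P[gR gI]; rewrite /inner /Cintegral; congr Complex.
  rewrite /rdot -RintegralD//; try exact: Lfun2_integrableM.
  by apply: eq_Rintegral => x _ /=; case: (f x) (g x) => [a b] [c d] /=; ring.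
rewrite /rdot -RintegralB//; try exact: Lfun2_integrableM.
by apply: eq_Rintegral => x _ /=; case: (f x) (g x) => [a b] [c d] /=; ring.
Qed.
End ComplexL2.

Section Coherent.
Variables (R : realType) (q beta : R).
Hypotheses (q_ge0 : 0 <= q) (q_lt1 : q < 1) (beta_gt0 : 0 < beta).
Variable mu : probability (measurableTypeR R) R.
Hypothesis mu_qpoisson : is_qpoisson q beta mu.
Local Notation C := (Cplx R).
Local Notation L2R := (Lfun mu 2%:E).
Local Notation w := (qweight q beta).
Local Notation charlier := (charlier q beta).
Local Notation normc := Normc.normc.

(** For s strictly between r^2 and beta / (1 - q), the weights dominate s^n, so
    the squared norms of the terms are O((r^2 / s)^n). *)
Lemma charlier_series_L2 (c : nat -> R) r : 0 <= r -> r ^+ 2 < beta / (1 - q) ->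
  (forall n, `|c n| <= r ^+ n / w n) ->
  exists2 g, g \in L2R &
    rdot mu (fun x => \sum_(i < n) c i * charlier i x - g x)
            (fun x => \sum_(i < n) c i * charlier i x - g x) @[n --> \oo] --> 0.
Proof.
move=> r0 rb cr.
have b0 : 0 < beta / (1 - q) by rewrite divr_gt0// subr_gt0.
pose s := (r ^+ 2 + beta / (1 - q)) / 2.
have rs : r ^+ 2 < s by rewrite /s; lra.
have s0 : 0 < s by apply: le_lt_trans rs; exact: sqr_ge0.
have sb : s < beta / (1 - q) by rewrite /s; lra.
have [k k0 kw] := qweight_ge_geometric q_ge0 q_lt1 beta_gt0 s0 sb.
(* any ratio t with r ^+ 2 / s < t ^+ 2 < 1 would do *)
pose t := Num.sqrt ((r ^+ 2 / s + 1) / 2).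
have rs1 : r ^+ 2 / s < 1 by rewrite ltr_pdivrMr ?mul1r.
have rs0 : 0 <= r ^+ 2 / s by rewrite divr_ge0 ?sqr_ge0// ltW.
have t0 : 0 < t by rewrite sqrtr_gt0; lra.
have t2 : t ^+ 2 = (r ^+ 2 / s + 1) / 2 by rewrite sqr_sqrtr//; lra.
have t1 : t < 1 by rewrite -ltr_sqr ?nnegrE ?(ltW t0)// t2 expr1n; lra.
apply: (@riesz_fischer_geometric _ _ _ mu charlier c (Num.sqrt k^-1) t) => //.
- exact: charlier_orthogonal.
move=> n; rewrite (charlier_norm mu_qpoisson).
have wn0 : 0 < w n by exact: qweight_gt0.
rewrite exprMn sqr_sqrtr ?invr_ge0 ?(ltW k0)// exprAC t2.
apply: (@le_trans _ _ ((r ^+ n / w n) ^+ 2 * w n)).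
  rewrite ler_wpM2r ?(ltW wn0)// -[leLHS]real_normK ?num_real//.
  by rewrite lerXn2r ?nnegrE// (le_trans _ (cr n)).
have -> : (r ^+ n / w n) ^+ 2 * w n = (r ^+ 2) ^+ n / w n.
  by rewrite exprMn exprAC; field; rewrite gt_eqF.
apply: (@le_trans _ _ ((r ^+ 2) ^+ n / (k * s ^+ n))).
  by rewrite ler_wpM2l ?exprn_ge0 ?sqr_ge0// lef_pV2// posrE mulr_gt0// exprn_gt0.
rewrite invfM mulrCA -expr_div_n ler_wpM2l ?invr_ge0 ?(ltW k0)//.
by rewrite lerXn2r ?nnegrE//; lra.
Qed.

Lemma Re_coherent_psum z n x : complex.Re (coherent_psum q beta z n x) =
  \sum_(i < n) (complex.Re (z ^+ i) / w i) * charlier i x.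
Proof.
rewrite /coherent_psum Re_sum.
apply: eq_bigr => i _; rewrite /charlier /qweight.
case: (z ^+ i) => a b /=; ring.
Qed.

Lemma Im_coherent_psum z n x : complex.Im (coherent_psum q beta z n x) =
  \sum_(i < n) (complex.Im (z ^+ i) / w i) * charlier i x.
Proof.
rewrite /coherent_psum Im_sum.
apply: eq_bigr => i _; rewrite /charlier /qweight.
case: (z ^+ i) => a b /=; ring.
Qed.
(** The set from which the coherent vector is chosen is inhabited: its real and
    imaginary parts are the L^2 sums of the series with coefficients
    Re (z^n) / w_n and Im (z^n) / w_n. *)
Lemma coherent_spec (z : C) : Omega q beta z ->
  let e := coherent q beta mu z in
  L2 mu e /\ L2norm mu (fun x => coherent_psum q beta z n x - e x) @[n --> \oo] --> 0%E.
Proof.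
move=> zO /=.
have zR n : `|complex.Re (z ^+ n) / w n| <= normc z ^+ n / w n.
  have wn0 : 0 < w n by exact: qweight_gt0.
  rewrite normrM [X in _ * X]gtr0_norm ?invr_gt0// ler_pM2r ?invr_gt0//.
  by rewrite -normcX -ler_sqr ?nnegrE ?normc_ge0// normc_sqrE real_normK ?num_real// lerDl sqr_ge0.
have zI n : `|complex.Im (z ^+ n) / w n| <= normc z ^+ n / w n.
  have wn0 : 0 < w n by exact: qweight_gt0.
  rewrite normrM [X in _ * X]gtr0_norm ?invr_gt0// ler_pM2r ?invr_gt0//.
  by rewrite -normcX -ler_sqr ?nnegrE ?normc_ge0// normc_sqrE real_normK ?num_real// lerDr sqr_ge0.
have [g gL gc] := charlier_series_L2 (normc_ge0 z) zO zR.
have [h hL hc] := charlier_series_L2 (normc_ge0 z) zO zI.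
pose e0 : R -> C := fun x => Complex (g x) (h x).
have [cL _] := charlier_orthogonal mu_qpoisson.
have [] := @getPex _ [set e | L2 mu e /\
    L2norm mu (fun x => coherent_psum q beta z N x - e x) @[N --> \oo] --> 0%E] => //.
have ReE n x : complex.Re (coherent_psum q beta z n x - e0 x) =
    \sum_(i < n) (complex.Re (z ^+ i) / w i) * charlier i x - g x.
  by rewrite ReD Re_coherent_psum.
have ImE n x : complex.Im (coherent_psum q beta z n x - e0 x) =
    \sum_(i < n) (complex.Im (z ^+ i) / w i) * charlier i x - h x.
  by rewrite ImD Im_coherent_psum.
exists e0; split; first by apply/L2P.
apply/L2norm_cvg0P => [n|].
  apply/L2P; split.
    by apply: eq_Lfun2 (Lfun2B (Lfun2_sum (fun i => complex.Re (z ^+ i) / w i) n cL) gL).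
  by apply: eq_Lfun2 (Lfun2B (Lfun2_sum (fun i => complex.Im (z ^+ i) / w i) n cL) hL).
split.
  by under eq_fun do rewrite (eq_fun (ReE _)).
by under eq_fun do rewrite (eq_fun (ImE _)).
Qed.

Definition sb_coef (f : R -> C) (n : nat) : C :=
  Complex (rdot mu (charlier n) (fun x => complex.Re (f x)) / w n)
          (rdot mu (charlier n) (fun x => complex.Im (f x)) / w n).

(** The conjugation of the parameter in the transform and the antilinearity of
    the inner product cancel, so that z^n appears unconjugated: the partial sum
    at the conjugate of z is pR - i pI, with pR and pI built from z itself. *)
Lemma segal_bargmann_expansion f : L2 mu f ->
  power_expansion q beta (segal_bargmann q beta mu f) (sb_coef f).
Proof.
move=> fL z zO; have [uL vL] := (L2P mu f).1 fL.
have zcO : Omega q beta (z^*) by move: zO; case: z => a b; rewrite /Omega /= sqrrN.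
have [eL ec] := coherent_spec zcO.
rewrite /segal_bargmann; set e := coherent q beta mu z^* in eL ec *.
have [eR eI] := (L2P mu e).1 eL.
have [cL _] := charlier_orthogonal mu_qpoisson.
pose pR n x := \sum_(i < n) (complex.Re (z ^+ i) / w i) * charlier i x.
pose pI n x := \sum_(i < n) (complex.Im (z ^+ i) / w i) * charlier i x.
have pRL n : pR n \in L2R by exact: (Lfun2_sum (fun i => complex.Re (z ^+ i) / w i)).
have pIL n : pI n \in L2R by exact: (Lfun2_sum (fun i => complex.Im (z ^+ i) / w i)).
have ReE n : (fun x => complex.Re (coherent_psum q beta z^* n x - e x)) =
    (fun x => pR n x - complex.Re (e x)).
  apply/funext => x; rewrite ReD ReN Re_coherent_psum; congr (_ - _).
  by apply: eq_bigr => i _; rewrite Re_conjX.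
have ImE n : (fun x => complex.Im (coherent_psum q beta z^* n x - e x)) =
    (fun x => - 1 * (pI n x - (- complex.Im (e x)))).
  apply/funext => x; rewrite ImD ImN Im_coherent_psum opprK mulrDr !mulN1r.
  congr (_ - _); rewrite -sumrN.
  by apply: eq_bigr => i _; rewrite Im_conjX !mulNr.
have NeI : (fun x => - complex.Im (e x)) \in L2R.
  by apply: eq_Lfun2 (Lfun2Z (-1) eI) => x; rewrite mulN1r.
have dL n : L2 mu (fun x => coherent_psum q beta z^* n x - e x).
  by apply/L2P; rewrite ReE ImE; split; [exact: Lfun2B|exact: Lfun2Z (Lfun2B _ _)].
have [cR cI] := (L2norm_cvg0P dL).1 ec.
have pRc g : g \in L2R -> rdot mu (pR n) g @[n --> \oo] --> rdot mu (fun x => complex.Re (e x)) g.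
  by move=> gL; apply: rdot_cvg => //; under eq_fun do rewrite -ReE.
have pIc g : g \in L2R -> rdot mu (pI n) g @[n --> \oo] --> rdot mu (fun x => - complex.Im (e x)) g.
  move=> gL; apply: rdot_cvg => //.
  suff -> : (fun n => rdot mu (fun x => pI n x - - complex.Im (e x))
                              (fun x => pI n x - - complex.Im (e x))) =
            (fun n => rdot mu (fun x => complex.Im (coherent_psum q beta z^* n x - e x))
                              (fun x => complex.Im (coherent_psum q beta z^* n x - e x))).
    exact: cI.
  by apply/funext => n; rewrite ImE; apply: eq_Rintegral => x _; ring.
have SR n : complex.Re (series (fun k => sb_coef f k * z ^+ k) n) =
    rdot mu (pR n) (fun x => complex.Re (f x)) - rdot mu (pI n) (fun x => complex.Im (f x)).
  rewrite /series/= Re_sum big_mkord.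
  rewrite (rdot_suml (fun i => complex.Re (z ^+ i) / w i))//.
  rewrite (rdot_suml (fun i => complex.Im (z ^+ i) / w i))// -sumrB; apply: eq_bigr => i _.
  by case: (z ^+ i) => a b /=; ring.
have SI n : complex.Im (series (fun k => sb_coef f k * z ^+ k) n) =
    rdot mu (pR n) (fun x => complex.Im (f x)) + rdot mu (pI n) (fun x => complex.Re (f x)).
  rewrite /series/= Im_sum big_mkord.
  rewrite (rdot_suml (fun i => complex.Re (z ^+ i) / w i))//.
  rewrite (rdot_suml (fun i => complex.Im (z ^+ i) / w i))// -big_split; apply: eq_bigr => i _ /=.
  by case: (z ^+ i) => a b /=; ring.
rewrite innerE//; apply: cvgC_ReIm => /=.
  under eq_fun do rewrite SR.
  by have := cvgB (pRc _ uL) (pIc _ vL); rewrite rdotNl// opprK => h; exact: h.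
under eq_fun do rewrite SI.
by have := cvgD (pRc _ vL) (pIc _ uL); rewrite rdotNl// => h; exact: h.
Qed.
End Coherent.

(** * Power series on the disc *)

Section PowerSeries.
Variables (R : realType) (q beta : R).
Hypotheses (q_ge0 : 0 <= q) (q_lt1 : q < 1) (beta_gt0 : 0 < beta).
Local Notation C := (Cplx R).
Local Notation normc := Normc.normc.
Local Notation w := (qweight q beta).
Local Notation rc := (real_complex R).
Local Notation pexp := (power_expansion q beta).
Implicit Types (F G : C -> C) (a b : nat -> C).

Lemma radius_gt0 : 0 < beta / (1 - q).
Proof. by rewrite divr_gt0// subr_gt0. Qed.

Lemma Omega_le (z : C) r : 0 <= r -> normc z <= r -> r ^+ 2 < beta / (1 - q) ->
  Omega q beta z.
Proof.
move=> r0 zr; apply: le_lt_trans.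
by rewrite lerXn2r ?nnegrE ?normc_ge0.
Qed.

Lemma Omega_qM (z : C) : Omega q beta z -> Omega q beta (rc q * z).
Proof.
move=> zO; apply: Omega_le zO; first exact: normc_ge0.
rewrite (Normc.normcM (rc q : C) z) normc_real ger0_norm//.
by rewrite ler_piMl ?normc_ge0// ltW.
Qed.

(** The coefficients satisfy |a_n| r^n <= B because the series converges at
    half the radius; for |z| <= r / 2 the remainder is then dominated by
    a geometric series of ratio 1/2. *)
Lemma pexp_taylor F a m : pexp F a ->
  exists K d : R, [/\ 0 <= K, 0 < d & forall z : C, normc z <= d ->
    normc (F z - \sum_(i < m) a i * z ^+ i) <= K * normc z ^+ m].
Proof.
move=> Fa; pose r := Num.sqrt (beta / (1 - q)) / 2.
have r0 : 0 < r by rewrite divr_gt0// sqrtr_gt0 radius_gt0.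
have r2 : r ^+ 2 < beta / (1 - q).
  rewrite exprMn sqr_sqrtr ?(ltW radius_gt0)// gtr_pMr ?radius_gt0//.
  by rewrite exprVn invf_lt1//; lra.
have rO : Omega q beta (rc r : C).
  by apply: (Omega_le (ltW r0)) => //; rewrite normc_real gtr0_norm.
have [B B0 aB] : exists2 B, 0 <= B & forall n, normc (a n) * r ^+ n <= B.
  have /cvg_series_cvg_0/cvgC_normP : cvgn (series (fun n => a n * rc r ^+ n)).
    by apply/cvg_ex; exists (F (rc r)); exact: Fa.
  move=> /cvgP/cvg_seq_bounded[M [_ MB]].
  exists (`|M| + 1) => [|n]; first by rewrite addr_ge0.
  have := MB (`|M| + 1) _ n I; rewrite (le_lt_trans (ler_norm _)) ?ltrDl// => /(_ isT).
  rewrite /= subr0 ger0_norm ?normc_ge0//.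
  rewrite (Normc.normcM (a n) (rc r ^+ n)) normcX normc_real gtr0_norm//.
exists (2 * B / r ^+ m), (r / 2); split.
- by rewrite divr_ge0 ?mulr_ge0// exprn_ge0// ltW.
- by rewrite divr_gt0.
move=> z zr; set t := normc z in zr *.
have t0 : 0 <= t by exact: normc_ge0.
have zO : Omega q beta z by apply: (Omega_le (ltW r0)) r2; rewrite -/t; lra.
have tr : t / r <= 2^-1 by rewrite ler_pdivrMr// mulrC.
have tr0 : 0 <= t / r by rewrite divr_ge0// ltW.
have term n : normc (a n * z ^+ n) <= B * (t / r) ^+ n.
  rewrite (Normc.normcM (a n) (z ^+ n)) normcX -/t expr_div_n mulrA.
  rewrite ler_pdivlMr ?exprn_gt0// mulrAC ler_wpM2r ?exprn_ge0//.
have tail k : normc (series (fun n => a n * z ^+ n) (m + k)%N - \sum_(i < m) a i * z ^+ i)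
    <= 2 * B / r ^+ m * t ^+ m.
  rewrite /series/= big_mkord big_split_ord/= addrAC subrr add0r.
  apply: le_trans (ler_normc_sum _ _ _) _.
  apply: (@le_trans _ _ (\sum_(i < k) B * (t / r) ^+ m * 2^-1 ^+ i)).
    apply: ler_sum => i _; apply: le_trans (term _) _.
    rewrite exprD mulrA ler_wpM2l ?mulr_ge0 ?exprn_ge0//.
    by rewrite lerXn2r ?nnegrE// invr_ge0.
  rewrite -(big_mkord xpredT (fun i => B * (t / r) ^+ m * 2^-1 ^+ i)).
  apply: le_trans (geometric_le_lim _ _ _ _) _.
  - by rewrite mulr_ge0// exprn_ge0.
  - by rewrite invr_gt0.
  - by rewrite ger0_norm ?invr_ge0//; lra.
  rewrite (_ : (1 - 2^-1)^-1 = 2); last by field.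
  by rewrite expr_div_n le_eqVlt; apply/orP; left; apply/eqP; ring.
apply/ler_addgt0Pr => e e0.
have /cvgC_normP/cvgr_lt/(_ _ e0)[N _ NF] := Fa z zO.
have := NF (m + N)%N (leq_addl _ _); rewrite /= => lim_e.
have -> : F z - \sum_(i < m) a i * z ^+ i =
   (series (fun n => a n * z ^+ n) (m + N)%N - \sum_(i < m) a i * z ^+ i)
   + - (series (fun n => a n * z ^+ n) (m + N)%N - F z) by ring.
apply: le_trans (le_normcD _ _) _; apply: lerD => //.
by rewrite normcN ltW.
Qed.

(** If the coefficients agree below m, then both Taylor estimates of order m + 1
    give |a_m - b_m| t^m = O(t^(m+1)) for small t > 0. *)
Lemma pexp_uniq F a b : pexp F a -> pexp F b -> a = b.
Proof.
move=> Fa Fb; apply/funext => n.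
elim/ltn_ind: n => m IH.
have [K [d [K0 d0 FK]]] := pexp_taylor m.+1 Fa.
have [L [d' [L0 d'0 FL]]] := pexp_taylor m.+1 Fb.
apply/eqP; rewrite -subr_eq0; apply/eqP/Normc.eq0_normc/eqP.
rewrite eq_le normc_ge0 andbT leNgt; apply/negP => ab0.
set D := normc (a m - b m) in ab0.
have KL0 : 0 < K + L + 1 by lra.
(* D <= (K + L) t, which fails once (K + L + 1) t <= D *)
pose t := Num.min (Num.min d d') (D / (K + L + 1)).
have t0 : 0 < t by rewrite !lt_min d0 d'0 divr_gt0.
have td : t <= d by rewrite !ge_min lexx.
have td' : t <= d' by rewrite !ge_min lexx orbT.
have tD : t * (K + L + 1) <= D by rewrite -ler_pdivlMr// ge_min lexx orbT.
have nt : normc (rc t : C) = t by rewrite normc_real gtr0_norm.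
have := FK (rc t); rewrite nt => /(_ td) hK.
have := FL (rc t); rewrite nt => /(_ td') hL.
have : normc ((a m - b m) * rc t ^+ m) <= K * t ^+ m.+1 + L * t ^+ m.+1.
  have -> : (a m - b m) * rc t ^+ m =
     (F (rc t) - \sum_(i < m.+1) b i * rc t ^+ i)
     + - (F (rc t) - \sum_(i < m.+1) a i * rc t ^+ i).
    rewrite !big_ord_recr/= (eq_bigr (fun i : 'I_m => a i * rc t ^+ i)); last first.
      by move=> i _; rewrite IH.
    by ring.
  apply: le_trans (le_normcD _ _) _; rewrite addrC lerD//.
  by rewrite normcN.
rewrite (Normc.normcM (a m - b m) (rc t ^+ m)) normcX nt -mulrDl exprS mulrA.
rewrite ler_pM2r ?exprn_gt0// -/D => Dt.
have : D < D by apply: le_lt_trans Dt _; apply: lt_le_trans tD; nra.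
by rewrite ltxx.
Qed.

Lemma pexp_at0 F a : pexp F a -> F 0 = a 0%N.
Proof.
move=> /(pexp_taylor 1)[K [d [_ d0]]] /(_ 0); rewrite (Normc.normc0 R) => /(_ (ltW d0)).
rewrite expr1 mulr0 big_ord1 expr0 mulr1 => h.
by apply/eqP; rewrite -subr_eq0; apply/eqP/Normc.eq0_normc/eqP; rewrite eq_le h normc_ge0.
Qed.

Lemma pexp_derive1_at0 F a : pexp F a -> derive1 F 0 = a 1%N.
Proof.
move=> Fa; have [K [d [K0 d0 FK]]] := pexp_taylor 2 Fa.
apply: cvg_lim => //.
apply/cvgrPdist_lt => e; rewrite ltcE => /andP[/eqP/= ie re].
have K1 : 0 < K + 1 by lra.
pose s := Num.min d (complex.Re e / (K + 1)).
have s0 : 0 < s by rewrite lt_min d0 divr_gt0.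
have sC : 0 < rc s :> C by rewrite ltcR.
have near_s : \forall h \near (0 : C)^', `|h| < rc s by exact: dnbhs0_lt.
have near_n0 : \forall h \near (0 : C)^', h != 0 by exact: nbhs_dnbhs_neq.
apply: filterS2 near_s near_n0 => h; rewrite normC_normc ltcR => hs h0.
have hn : 0 < normc h.
  rewrite lt_neqAle normc_ge0 andbT eq_sym; apply: contraNneq h0 => h0.
  exact/eqP/Normc.eq0_normc.
have := FK h; rewrite (pexp_at0 Fa) addr0.
move=> /(_ _); rewrite ltW ?(lt_le_trans hs) ?ge_min ?lexx// => /(_ isT).
rewrite !big_ord_recr big_ord0 /= add0r expr0 mulr1 expr1 => hK.
have -> : a 1%N - h^-1 *: (F h - a 0%N) = - (h^-1 * (F h - (a 0%N + a 1%N * h))).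
  by rewrite /GRing.scale/=; field.
rewrite normrN normC_normc ltcE /= ie eqxx /=.
rewrite (Normc.normcM h^-1 (F h - (a 0%N + a 1%N * h))) Normc.normcV.
apply: (@le_lt_trans _ _ ((normc h)^-1 * (K * normc h ^+ 2))).
  by rewrite ler_wpM2l ?invr_ge0 ?(ltW hn).
have -> : (normc h)^-1 * (K * normc h ^+ 2) = K * normc h.
  by field; rewrite gt_eqF.
have : normc h * (K + 1) < complex.Re e.
  by rewrite -ltr_pdivlMr// (lt_le_trans hs)// ge_min lexx orbT.
by nra.
Qed.

Lemma eq_pexp F G a : (forall z, Omega q beta z -> F z = G z) -> pexp F a -> pexp G a.
Proof. by move=> FG Fa z zO; rewrite -FG//; exact: Fa. Qed.

Lemma pexp_linear (c : C) F G a b : pexp F a -> pexp G b ->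
  pexp (fun z => c * F z + G z) (fun n => c * a n + b n).
Proof.
move=> Fa Gb z zO.
have -> : series (fun n => (c * a n + b n) * z ^+ n) =
    (fun n => c * series (fun n => a n * z ^+ n) n + series (fun n => b n * z ^+ n) n).
  apply/funext => n; rewrite /series/= mulr_sumr -big_split; apply: eq_bigr => i _ /=.
  by ring.
by apply: cvgD; [apply: cvgMr; exact: Fa|exact: Gb].
Qed.

Lemma pexp_monomial k : pexp (fun z => z ^+ k) (fun n => (n == k)%:R).
Proof.
move=> z zO; apply: cvg_near_cst; near=> n.
rewrite /series/= big_mkord.
have kn : (k < n)%N by near: n; exact: nbhs_infty_gt.
rewrite (bigD1 (Ordinal kn))//= eqxx mul1r big1 ?addr0// => i.
by rewrite -val_eqE/= => /negbTE ->; rewrite mul0r.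
Unshelve. all: by end_near. Qed.

(** Also used with N = 0 to supply the zero series. *)
Lemma pexp_poly (c : nat -> C) N :
  pexp (fun z => \sum_(i < N) c i * z ^+ i) (fun n => if (n < N)%N then c n else 0).
Proof.
elim: N => [|N IH].
  move=> z zO; rewrite big_ord0; apply: cvg_near_cst; apply: nearW => n.
  by rewrite /series/= big1// => i _; rewrite mul0r.
have -> : (fun n => if (n < N.+1)%N then c n else 0) =
    (fun n => c N * (n == N)%:R + (if (n < N)%N then c n else 0)).
  apply/funext => n; rewrite ltnS leq_eqVlt.
  case: eqP => [->|_] /=; first by rewrite ltnn mulr1 addr0.
  by rewrite mulr0 add0r.
have cNS := pexp_linear (c := c N) (@pexp_monomial N) IH.
apply: eq_pexp cNS => z _.
by rewrite big_ord_recr/= addrC.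
Qed.

Lemma pexp_qdilation F a : pexp F a ->
  pexp (fun z => F (rc q * z)) (fun n => rc (q ^+ n) * a n).
Proof.
move=> Fa z zO; have := Fa _ (Omega_qM zO).
suff -> : series (fun n => a n * (rc q * z) ^+ n) =
  series (fun n => rc (q ^+ n) * a n * z ^+ n) by [].
apply/funext => n; apply: eq_bigr => i _.
by rewrite exprMn rmorphXn; ring.
Qed.

Lemma hardy_coefE F a : pexp F a -> hardy_coef q beta F = a.
Proof.
move=> Fa; have h : pexp F (hardy_coef q beta F) by apply: getPex; exists a.
exact: pexp_uniq h Fa.
Qed.
End PowerSeries.

(** * The Hardy space and the operator alpha_N *)

Section Hardy.
Variables (R : realType) (q beta : R).
Hypotheses (q_ge0 : 0 <= q) (q_lt1 : q < 1) (beta_gt0 : 0 < beta).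
Local Notation C := (Cplx R).
Local Notation normc := Normc.normc.
Local Notation w := (qweight q beta).
Local Notation rc := (real_complex R).
Local Notation pexp := (power_expansion q beta).
Local Notation hw := (hardy_weights q beta).
Implicit Types (F G : C -> C) (a b : nat -> C).

Lemma hardy_weightsE a n : hw a n = w n * normc (a n) ^+ 2.
Proof. by []. Qed.

Lemma hardy_weights_ge0 a n : 0 <= hw a n.
Proof. by rewrite hardy_weightsE mulr_ge0 ?sqr_ge0// ltW// qweight_gt0. Qed.

Lemma nd_series_hw a : nondecreasing_seq (series (hw a)).
Proof. by apply: nondecreasing_series => n _ _; exact: hardy_weights_ge0. Qed.

Lemma cvg_series_hw_le a M : (forall n, series (hw a) n <= M) ->
  cvgn (series (hw a)) /\ limn (series (hw a)) <= M.
Proof.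
move=> aM; have ca : cvgn (series (hw a)).
  by apply: nondecreasing_is_cvgn; [exact: nd_series_hw|exists M => _ [n _ <-]].
by split=> //; apply: limr_le => //; exact: nearW.
Qed.

Lemma series_hw_le_lim a n : cvgn (series (hw a)) ->
  series (hw a) n <= limn (series (hw a)).
Proof. by move=> ca; apply: nondecreasing_cvgn_le => //; exact: nd_series_hw. Qed.

Lemma hw_le_lim a n : cvgn (series (hw a)) -> hw a n <= limn (series (hw a)).
Proof.
move=> ca; apply: le_trans (series_hw_le_lim n.+1 ca).
rewrite /series/= big_nat_recr//= lerDr sumr_ge0// => i _.
exact: hardy_weights_ge0.
Qed.

Lemma hardy_normE F a : pexp F a ->
  hardy_norm q beta F = Num.sqrt (limn (series (hw a))).
Proof. by move=> Fa; rewrite /hardy_norm (hardy_coefE q_lt1 beta_gt0 Fa). Qed.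

Lemma hardy_norm_ge0 F : 0 <= hardy_norm q beta F.
Proof. exact: sqrtr_ge0. Qed.

Lemma hardy_norm_sqr F a : pexp F a -> cvgn (series (hw a)) ->
  hardy_norm q beta F ^+ 2 = limn (series (hw a)).
Proof.
move=> Fa ca; rewrite (hardy_normE Fa) sqr_sqrtr//.
by apply: le_trans (hw_le_lim 0 ca); exact: hardy_weights_ge0.
Qed.

Definition alpha_coef n : R := qnum q n + beta.

Lemma alpha_coef_ge0 n : 0 <= alpha_coef n.
Proof. by rewrite addr_ge0 ?qnum_ge0// ltW. Qed.

Lemma alpha_coef_le n : alpha_coef n <= (1 - q)^-1 + beta.
Proof. by rewrite lerD2r qnum_le. Qed.

(** An explicit form of alpha_N; it shows that the set of operators defining
    alpha_N is inhabited. *)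
Definition qnumber_op (F : C -> C) : C -> C := fun z =>
  rc (1 - q)^-1 * (F z - F (rc q * z)) + rc beta * F z.

Lemma qnumber_op_pexp F a : pexp F a ->
  pexp (qnumber_op F) (fun n => rc (alpha_coef n) * a n).
Proof.
move=> Fa; have Fqa := pexp_qdilation q_ge0 q_lt1 Fa.
have h := pexp_linear (c := rc (1 - q)^-1 + rc beta) Fa
  (pexp_linear (c := - rc (1 - q)^-1) Fqa (@pexp_poly _ q beta (fun=> 0) 0)).
have -> : (fun n => rc (alpha_coef n) * a n) =
    (fun n => (rc (1 - q)^-1 + rc beta) * a n +
       (- rc (1 - q)^-1 * (rc (q ^+ n) * a n) + (if (n < 0)%N then 0 else 0))).
  apply/funext => n; rewrite ltn0 addr0 /alpha_coef (qnumE q_lt1).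
  rewrite rmorphD rmorphM rmorphB rmorph1; ring.
by apply: eq_pexp h => z _; rewrite big_ord0 /qnumber_op; ring.
Qed.

Lemma alpha_coef_hw a n :
  hw (fun n => rc (alpha_coef n) * a n) n <= ((1 - q)^-1 + beta) ^+ 2 * hw a n.
Proof.
rewrite !hardy_weightsE [leRHS]mulrCA ler_wpM2l ?(ltW (qweight_gt0 _ _ _ _))//.
rewrite (Normc.normcM (rc (alpha_coef n) : C) (a n)) normc_real exprMn.
rewrite ler_wpM2r ?sqr_ge0// ger0_norm ?alpha_coef_ge0//.
rewrite lerXn2r ?nnegrE ?alpha_coef_ge0 ?alpha_coef_le//.
exact: le_trans (alpha_coef_ge0 n) (alpha_coef_le n).
Qed.

Lemma alpha_coef_series a n :
  series (hw (fun n => rc (alpha_coef n) * a n)) n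
  <= ((1 - q)^-1 + beta) ^+ 2 * series (hw a) n.
Proof.
by rewrite /series/= mulr_sumr; apply: ler_sum => i _; exact: alpha_coef_hw.
Qed.

Lemma alpha_coef_cvg a : cvgn (series (hw a)) ->
  cvgn (series (hw (fun n => rc (alpha_coef n) * a n))) /\
  limn (series (hw (fun n => rc (alpha_coef n) * a n)))
    <= ((1 - q)^-1 + beta) ^+ 2 * limn (series (hw a)).
Proof.
move=> ca; apply: cvg_series_hw_le => n; apply: le_trans (alpha_coef_series a n) _.
by rewrite ler_wpM2l ?sqr_ge0// series_hw_le_lim.
Qed.

Lemma qnumber_op_bounded_linear : bounded_linear q beta qnumber_op.
Proof.
split=> [F [a Fa ca]|c F G _ _ z _|].
- by exists (fun n => rc (alpha_coef n) * a n);
    [exact: qnumber_op_pexp|exact: (alpha_coef_cvg ca).1].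
- by rewrite /qnumber_op; ring.
exists ((1 - q)^-1 + beta) => F [a Fa ca].
have M0 : 0 <= (1 - q)^-1 + beta.
  by rewrite addr_ge0 ?invr_ge0 ?subr_ge0 ?ltW.
have [cAa Aa_le] := alpha_coef_cvg ca.
have AF2 := hardy_norm_sqr (qnumber_op_pexp Fa) cAa.
have F2 := hardy_norm_sqr Fa ca.
have AF0 := hardy_norm_ge0 (qnumber_op F); have F0 := hardy_norm_ge0 F.
move: (hardy_norm _ _ _) (hardy_norm _ _ _) AF0 F0 AF2 F2 => y x y0 x0 y2 x2.
by rewrite -ler_sqr ?nnegrE ?mulr_ge0// exprMn y2 x2.
Qed.

Lemma qnumber_op_monomial n (z : C) :
  qnumber_op (fun w => w ^+ n) z = rc (qnum q n + beta) * z ^+ n.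
Proof.
rewrite /qnumber_op exprMn (qnumE q_lt1) rmorphD rmorphM rmorphB rmorph1 rmorphXn.
by ring.
Qed.

Definition coef_tail a N : nat -> C := fun n => if (n < N)%N then 0 else a n.
Definition fun_tail F a N : C -> C := fun z => F z - \sum_(i < N) a i * z ^+ i.

Lemma pexp_tail F a N : pexp F a -> pexp (fun_tail F a N) (coef_tail a N).
Proof.
move=> Fa.
have h := pexp_linear (c := -1) (@pexp_poly _ q beta a N) Fa.
have -> : coef_tail a N = (fun n => -1 * (if (n < N)%N then a n else 0) + a n).
  by apply/funext => n; rewrite /coef_tail; case: ifP => _; ring.
by apply: eq_pexp h => z _; rewrite /fun_tail; ring.
Qed.

Lemma series_hw_tail a N k :
  series (hw (coef_tail a N)) k = series (hw a) (maxn k N) - series (hw a) N.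
Proof.
elim: k => [|k IH]; first by rewrite max0n subrr /series/= big_geq.
have -> : series (hw (coef_tail a N)) k.+1 =
    series (hw (coef_tail a N)) k + hw (coef_tail a N) k.
  by rewrite /series/= big_nat_recr.
rewrite IH hardy_weightsE /coef_tail; case: ltnP => kN.
  rewrite (Normc.normc0 R) expr0n mulr0 addr0.
  by rewrite (maxn_idPr kN).
rewrite (maxn_idPl (leqW kN)) addrAC; congr (_ - _).
by rewrite /series/= big_nat_recr.
Qed.

Lemma cvg_tail a N : cvgn (series (hw a)) ->
  cvgn (series (hw (coef_tail a N))) /\
  limn (series (hw (coef_tail a N))) <= limn (series (hw a)) - series (hw a) N.
Proof.
move=> ca; apply: cvg_series_hw_le => n.
by rewrite series_hw_tail lerD2r series_hw_le_lim.
Qed.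

(** Splitting F at order N, the operator is known on the polynomial part, and
    the coefficient m < N of the image of the tail is bounded, up to the
    weight w_m, by the Hardy norm of that image, hence by M times the norm of
    the tail, which tends to 0. So the coefficients of A F are those obtained
    termwise. *)
Lemma bounded_linear_pexp A F a :
  bounded_linear q beta A ->
  (forall n (z : C), Omega q beta z ->
     A (fun w => w ^+ n) z = rc (qnum q n + beta) * z ^+ n) ->
  pexp F a -> cvgn (series (hw a)) ->
  pexp (A F) (fun n => rc (alpha_coef n) * a n).
Proof.
move=> [Ah Al [M AM]] Amon Fa ca.
have tailh N : hardy q beta (fun_tail F a N).
  by exists (coef_tail a N); [exact: pexp_tail|exact: (cvg_tail N ca).1].
have monh N : hardy q beta (fun w => w ^+ N).
  exists (fun n => (n == N)%:R); first exact: pexp_monomial.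
  have [] := @cvg_series_hw_le (fun n => (n == N)%:R) (w N) => // n.
  rewrite /series/= big_mkord.
  apply: (@le_trans _ _ (\sum_(i < n) if (i == N :> nat) then w N else 0)).
    apply: ler_sum => i _; rewrite hardy_weightsE; case: eqP => [->|_].
      by rewrite (Normc.normc1 R) expr1n mulr1.
    by rewrite (Normc.normc0 R) expr0n mulr0.
  rewrite -big_mkcond/=; have [Nn|nN] := ltnP N n.
    by rewrite (big_pred1 (Ordinal Nn)).
  rewrite big1 ?(ltW (qweight_gt0 _ _ _ _))// => i /eqP iN.
  by have := ltn_ord i; rewrite iN ltnNge nN.
have Fh : hardy q beta F by exists a.
have [b AFb cb] := Ah _ Fh.
have AFE N (z : C) : Omega q beta z ->
    A F z = \sum_(i < N) rc (alpha_coef i) * a i * z ^+ i + A (fun_tail F a N) z.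
  move=> zO; elim: N => [|N ->].
    rewrite big_ord0 add0r; congr (A _ z).
    by apply/funext => x; rewrite /fun_tail big_ord0 subr0.
  have -> : fun_tail F a N = (fun x => a N * x ^+ N + fun_tail F a N.+1 x).
    by apply/funext => x; rewrite /fun_tail big_ord_recr/=; ring.
  rewrite (Al _ _ _ (monh N) (tailh N.+1) z zO) (Amon N z zO) big_ord_recr/=.
  by rewrite mulrCA !mulrA addrA.
suff -> : (fun n => rc (alpha_coef n) * a n) = b by [].
apply/funext => m; apply/esym/eqP; rewrite -subr_eq0.
apply/eqP/Normc.eq0_normc.
set D := normc _.
have Dle N : (m < N)%N -> w m * D ^+ 2 <= M ^+ 2 * (limn (series (hw a)) - series (hw a) N).
  move=> mN.
  have [t AGt ct] := Ah _ (tailh N).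
  have bE : b = (fun n => 1 * (if (n < N)%N then rc (alpha_coef n) * a n else 0) + t n).
    apply: (pexp_uniq q_lt1 beta_gt0 AFb).
    have h := pexp_linear (c := 1)
      (@pexp_poly _ q beta (fun n => rc (alpha_coef n) * a n) N) AGt.
    by apply: eq_pexp h => z zO; rewrite (AFE N)// mul1r.
  have -> : D = normc (t m).
    by rewrite /D bE mN mul1r addrAC subrr add0r.
  rewrite -hardy_weightsE; apply: le_trans (hw_le_lim m ct) _.
  have [cta ta_le] := cvg_tail N ca.
  have AG2 := hardy_norm_sqr AGt ct.
  have G2 := hardy_norm_sqr (pexp_tail (N := N) Fa) cta.
  have AG0 := hardy_norm_ge0 (A (fun_tail F a N)).
  have AG_le := AM _ (tailh N).
  rewrite -AG2; apply: le_trans (ler_wpM2l (sqr_ge0 M) ta_le); rewrite -G2.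
  move: (hardy_norm _ _ _) (hardy_norm _ _ _) AG0 AG_le {AG2 G2} => y x y0 yx.
  by rewrite -exprMn lerXn2r ?nnegrE// (le_trans y0).
have wD0 : w m * D ^+ 2 <= 0.
  have lim0 : M ^+ 2 * (limn (series (hw a)) - series (hw a) N) @[N --> \oo] --> (0 : R).
    rewrite -[X in _ --> X](mulr0 (M ^+ 2)); apply: cvgMr.
    by rewrite -(subrr (limn (series (hw a)))); apply: cvgB => //; exact: cvg_cst.
  rewrite -(cvg_lim (@Rhausdorff R) lim0); apply: limr_ge; first exact/cvgP/lim0.
  by near=> N; apply: Dle; near: N; exact: nbhs_infty_gt.
have := qweight_gt0 q_ge0 q_lt1 beta_gt0 m => wm0.
move: wD0; rewrite pmulr_rle0// => D0.
by apply/eqP; rewrite -sqrf_eq0 eq_le D0 sqr_ge0.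
Unshelve. all: by end_near. Qed.

(** Both operators act on coefficients in the same way, so the choice made in the
    definition of alpha_N is immaterial on the disc. *)
Lemma alphaNE F z : hardy q beta F -> Omega q beta z ->
  alphaN q beta F z = qnumber_op F z.
Proof.
move=> [a Fa ca] zO.
have [Abl Amon] : [set A | bounded_linear q beta A /\
    forall n (z : C), Omega q beta z ->
      A (fun w => w ^+ n) z = rc (qnum q n + beta) * z ^+ n] (alphaN q beta).
  apply: getPex; exists qnumber_op; split; first exact: qnumber_op_bounded_linear.
  by move=> n x _; exact: qnumber_op_monomial.
have h := bounded_linear_pexp Abl Amon Fa ca.
exact: cvg_unique (h z zO) (qnumber_op_pexp Fa zO).
Qed.
End Hardy.

(** * Intertwining of the two actions *)

Section Intertwining.
Variables (R : realType) (q beta : R).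
Hypotheses (q_ge0 : 0 <= q) (q_lt1 : q < 1) (beta_gt0 : 0 < beta).
Variable mu : probability (measurableTypeR R) R.
Hypothesis mu_qpoisson : is_qpoisson q beta mu.
Local Notation C := (Cplx R).
Local Notation L2R := (Lfun mu 2%:E).
Local Notation w := (qweight q beta).
Local Notation rc := (real_complex R).
Local Notation pexp := (power_expansion q beta).
Local Notation charlier := (charlier q beta).

Definition shift_coef (a : nat -> C) : nat -> C :=
  fun n => if n is m.+1 then a m else 0.

Lemma shift_coef0 a : shift_coef a 0 = 0. Proof. by []. Qed.

Lemma shift_coefS a n : shift_coef a n.+1 = a n. Proof. by []. Qed.

Lemma pexp_mulX (F : C -> C) a : pexp F a -> pexp (fun z => z * F z) (shift_coef a).
Proof.
move=> Fa z zO; rewrite -cvg_shiftS /=.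
have -> : (fun n => series (fun k => shift_coef a k * z ^+ k) n.+1) =
    (fun n => z * series (fun k => a k * z ^+ k) n).
  apply/funext => n; rewrite /series/= big_nat_recl//= mul0r add0r mulr_sumr.
  by apply: eq_bigr => i _; rewrite exprS; ring.
by apply: cvgMr; exact: Fa.
Qed.

(** Multiplying by z avoids separating the origin in the definition of D. *)
Lemma pexp_mulX_Dq (F : C -> C) a : pexp F a ->
  pexp (fun z => z * Dq q beta F z) (fun n => rc (beta * qnum q n) * a n).
Proof.
move=> Fa; have Fqa := pexp_qdilation q_ge0 q_lt1 Fa.
have q1 : (1 - rc q : C) != 0.
  by rewrite -(rmorph1 rc) -rmorphB fmorph_eq0 subr_eq0 gt_eqF.
have h := pexp_linear (c := rc beta / (1 - rc q)) Fa
  (pexp_linear (c := - (rc beta / (1 - rc q))) Fqa (@pexp_poly _ q beta (fun=> 0) 0)).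
have -> : (fun n => rc (beta * qnum q n) * a n) =
    (fun n => rc beta / (1 - rc q) * a n +
       (- (rc beta / (1 - rc q)) * (rc (q ^+ n) * a n) + (if (n < 0)%N then 0 else 0))).
  apply/funext => n; rewrite ltn0 addr0 (qnumE q_lt1).
  rewrite !rmorphM rmorphB rmorph1 fmorphV rmorphB rmorph1; field; exact: q1.
apply: eq_pexp h => z _; rewrite big_ord0 /Dq.
case: eqP => [->|/eqP z0]; first by rewrite mulr0 mul0r; ring.
by field; rewrite q1 z0.
Qed.

(** The partial sums of the squared Hardy norm are those of Bessel's inequality
    for the real and imaginary parts of f. *)
Lemma segal_bargmann_hardy f : L2 mu f -> hardy q beta (segal_bargmann q beta mu f).
Proof.
move=> fL; have [uL vL] := (L2P mu f).1 fL.
exists (sb_coef q beta mu f); first exact: segal_bargmann_expansion.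
have oc := charlier_orthogonal mu_qpoisson.
have c0 n : 0 < rdot mu (charlier n) (charlier n).
  by rewrite (charlier_norm mu_qpoisson) qweight_gt0.
apply: (cvg_series_hw_le q_ge0 q_lt1 beta_gt0 _).1 => n.
have := lerD (bessel n oc c0 uL) (bessel n oc c0 vL).
apply: le_trans; rewrite -big_split /series/= big_mkord.
rewrite le_eqVlt; apply/orP; left; apply/eqP; apply: eq_bigr => i _.
rewrite hardy_weightsE normc_sqrE /= (charlier_norm mu_qpoisson); field.
by rewrite gt_eqF// qweight_gt0.
Qed.

Lemma Qp_L2 f : L2 mu f -> L2 mu (Qp f).
Proof.
move=> /L2P[uL vL]; apply/L2P; split.
  apply: eq_Lfun2 (Lfun2_mulX mu_qpoisson uL) => x; rewrite /Qp.
  by case: (f x) => a b /=; ring.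
apply: eq_Lfun2 (Lfun2_mulX mu_qpoisson vL) => x; rewrite /Qp.
by case: (f x) => a b /=; ring.
Qed.

(** The recurrence after division by the weights: w_(n+1) = beta [n+1]_q w_n
    moves the factor beta [n]_q from the lower to the upper neighbour. *)
Lemma charlier_coef_mulX n u : u \in L2R ->
  rdot mu (charlier n) (fun x => x * u x) / w n =
  beta * qnum q n.+1 * (rdot mu (charlier n.+1) u / w n.+1)
  + alpha_coef q beta n * (rdot mu (charlier n) u / w n)
  + (if n is m.+1 then rdot mu (charlier m) u / w m else 0).
Proof.
move=> uL; rewrite (rdot_charlier_mulX mu_qpoisson)// /alpha_coef.
have b0 : beta != 0 by rewrite gt_eqF.
have w0 k : w k != 0 by rewrite gt_eqF// qweight_gt0.
have q0 k : qnum q k.+1 != 0 by rewrite gt_eqF// qnum_gt0.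
case: n => [|n]; rewrite /= !qweightS.
  by rewrite qnum0; field; rewrite b0 w0 q0.
by field; rewrite b0 w0 !q0.
Qed.

Lemma sb_coef_Qp f n : L2 mu f -> sb_coef q beta mu (Qp f) n =
  rc (beta * qnum q n.+1) * sb_coef q beta mu f n.+1
  + rc (alpha_coef q beta n) * sb_coef q beta mu f n
  + shift_coef (sb_coef q beta mu f) n.
Proof.
move=> /L2P[uL vL]; rewrite /sb_coef.
have -> : (fun x => complex.Re (Qp f x)) = (fun x => x * complex.Re (f x)).
  by apply/funext => x; rewrite /Qp; case: (f x) => a b /=; ring.
have -> : (fun x => complex.Im (Qp f x)) = (fun x => x * complex.Im (f x)).
  by apply/funext => x; rewrite /Qp; case: (f x) => a b /=; ring.
rewrite !charlier_coef_mulX//; case: n => [|n] /=; apply/eqP; rewrite eq_complex /=;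
  by apply/andP; split; apply/eqP; ring.
Qed.
End Intertwining.

Theorem theorem4p3 (R : realType) (q beta : R)
    (hq0 : 0 <= q) (hq1 : q < 1) (hbeta : 0 < beta)
    (mu : probability (measurableTypeR R) R) (hmu : is_qpoisson q beta mu) :
  forall f : R -> Cplx R, L2 mu f ->
  forall z : Cplx R, Omega q beta z ->
    let S := segal_bargmann q beta mu in
    S (Qp f) z
    = Dq q beta (S f) z + Zq (S f) z + alphaN q beta (S f) z.
Proof.
move=> f fL z zO /=.
set F := segal_bargmann q beta mu f; set a := sb_coef q beta mu f.
have Fa : power_expansion q beta F a by exact: segal_bargmann_expansion.
have Gb := segal_bargmann_expansion hq0 hq1 hbeta hmu (Qp_L2 hmu fL).
have bE n := sb_coef_Qp hq0 hq1 hbeta hmu n fL.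
have Aa := qnumber_op_pexp hq0 hq1 Fa.
rewrite (alphaNE hq0 hq1 hbeta (segal_bargmann_hardy hq0 hq1 hbeta hmu fL) zO).
have [->|z0] := eqVneq z 0.
  rewrite (pexp_at0 hq1 hbeta Gb) (pexp_at0 hq1 hbeta Aa) bE /=.
  rewrite /Dq eqxx (pexp_derive1_at0 hq1 hbeta Fa) /Zq mul0r !addr0.
  by rewrite qnumS qnum0 expr0 add0r mulr1.
(* After multiplication by z, the operator D acts on coefficients by
   a_n |-> beta [n]_q a_n and the origin needs no convention. *)
apply: (mulfI z0); rewrite [RHS]mulrDr [X in _ = X + _]mulrDr.
have hD := pexp_mulX_Dq hq0 hq1 Fa.
have hZ := pexp_mulX (pexp_mulX Fa).
have hA := pexp_mulX Aa.
have h := pexp_linear (c := 1) hD (pexp_linear (c := 1) hZ hA).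
have hG := pexp_mulX Gb.
have E : shift_coef (sb_coef q beta mu (Qp f)) =
   (fun n => 1 * (real_complex R (beta * qnum q n) * a n) +
     (1 * shift_coef (shift_coef a) n +
      shift_coef (fun n => real_complex R (alpha_coef q beta n) * a n) n)).
  apply/funext => -[|n].
    by rewrite !shift_coef0 qnum0 mulr0 rmorph0; ring.
  by rewrite !shift_coefS bE -/a; ring.
rewrite E in hG.
have := cvg_unique (@norm_hausdorff _ _) (hG z zO) (h z zO).
by rewrite !mul1r addrA; exact.
Qed.
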